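(* $\mathrm{FO}(\mathrm{dep}(\cdots),\approx)<\mathrm{FO}(\perp\!\!\!\perp)$; that is, every formula of $\mathrm{FO}(\mathrm{dep}(\cdots),\approx)$ has an equivalent formula (same class $\mathrm{Struc}_{d[0,1]}$) in $\mathrm{FO}(\perp\!\!\!\perp)$, but some formula of $\mathrm{FO}(\perp\!\!\!\perp)$ has no equivalent formula in $\mathrm{FO}(\mathrm{dep}(\cdots),\approx)$.
   Context: Teams and probabilistic team semantics. A team $X$ is a finite set of assignments $s\colon D\to A$ for a finite set $D$ of first-order variables (its variable domain) and a finite set $A$. A probabilistic team is a function $\mathbb X\colon X\to[0,1]$ with $\sum_{s\in X}\mathbb X(s)=1$ (the empty function is also a probabilistic team). Write $\mathrm{supp}(\mathbb X)=\{s:\mathbb X(s)>0\}$, $|\mathbb X|=\sum_s\mathbb X(s)$, and for a first-order formula $\alpha$, $\mathbb X_\alpha$ is the restriction of $\mathbb X$ to assignments satisfying $\alpha$; e.g. $|\mathbb X_{\vec x=\vec a}|$ is the total weight of assignments mapping $\vec x$ to $\vec a$. Sums and scalar multiples of teams are pointwise. The marginal of $\mathbb X$ on a variable set $V$ is $s\mapsto\sum_{t\upharpoonright V=s}\mathbb X(t)$. For a variable $x$ and finite set $A$, $\mathbb X[A/x]$ is the team on all assignments $s$ over $\mathrm{Dom}(\mathbb X)\cup\{x\}$ with $s(x)\in A$ whose restriction to $\mathrm{Dom}(\mathbb X)\setminus\{x\}$ lies in the support of the marginal $\mathbb X'$ of $\mathbb X$ on $\mathrm{Dom}(\mathbb X)\setminus\{x\}$,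 given by $s\mapsto\mathbb X'(s\upharpoonright(\mathrm{Dom}(\mathbb X)\setminus\{x\}))/|A|$. Formulae are in negation normal form. For a $\tau$-structure $\mathfrak A$ with domain $A$: $\mathfrak A\models_{\mathbb X}l$ for a first-order literal $l$ iff $\mathfrak A\models_s l$ for all $s\in\mathrm{supp}(\mathbb X)$; $\mathfrak A\models_{\mathbb X}\psi\wedge\theta$ iff both hold; $\mathfrak A\models_{\mathbb X}\psi\vee\theta$ iff there are probabilistic teams $\mathbb Y,\mathbb Z$ and $\alpha\in[0,1]$ with $\alpha\mathbb Y+(1-\alpha)\mathbb Z=\mathbb X$, $\mathfrak A\models_{\mathbb Y}\psi$ and $\mathfrak A\models_{\mathbb Z}\theta$; $\mathfrak A\models_{\mathbb X}\forall x\psi$ iff $\mathfrak A\models_{\mathbb X[A/x]}\psi$; $\mathfrak A\models_{\mathbb X}\exists x\psi$ iff $\mathfrak A\models_{\mathbb Y}\psi$ for some probabilistic team $\mathbb Y$ over $\mathrm{Dom}(\mathbb X)\cup\{x\}$ with $x$-values in $A$ whose marginal on $\mathrm{Dom}(\mathbb X)\setminus\{x\}$ equals that of $\mathbb X$. Atoms. Marginal identity $\vec x\approx\vec y$ ($\vec x,\vec y$ of equal length $k$): $|\mathbb X_{\vec x=\vec a}|=|\mathbb X_{\vec y=\vec a}|$ for all $\vec a\in A^k$. Dependence $\mathrm{dep}(\vec x,y)$: all $s,s'\in\mathrm{supp}(\mathbb X)$ with $s(\vec x)=s'(\vec x)$ satisfy $s(y)=s'(y)$ (for empty $\vec x$,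 written $\mathrm{dep}(y)$: $y$ is constant on the support). Marginal independence $\vec y\perp\!\!\!\perp\vec z$: $|\mathbb X_{\vec y=\vec b}|\cdot|\mathbb X_{\vec z=\vec c}|=|\mathbb X_{\vec y\vec z=\vec b\vec c}|\cdot|\mathbb X|$ for all tuples $\vec b,\vec c$. $\mathrm{FO}(\mathcal C)$ is first-order logic extended with the atoms in $\mathcal C$; $\mathrm{FO}(\mathrm{dep}(\cdots),\approx)$ adds dependence and marginal identity atoms, $\mathrm{FO}(\perp\!\!\!\perp)$ adds marginal independence atoms. Comparison. For a probabilistic team $\mathbb X$ with variable domain $\{x_1,\dots,x_n\}$ and values in $A$, $f_{\mathbb X}\colon A^n\to[0,1]$ is given by $f_{\mathbb X}(s(x_1),\dots,s(x_n))=\mathbb X(s)$ for $s$ in the team and $0$ elsewhere. A $d[0,1]$-structure of vocabulary $\tau\cup\{f\}$ is a finite $\tau$-structure (at least two elements) expanded by a probability distribution $f^{\mathfrak A}$ on $A^{\mathrm{ar}(f)}$. For $\phi\in\mathrm{FO}(\mathcal C)$ of vocabulary $\tau$ with free variables $x_1,\dots,x_n$, $\mathrm{Struc}_{d[0,1]}(\phi)$ is the class of $d[0,1]$-structures $\mathfrak A$ of vocabulary $\tau\cup\{f\}$ ($f$ $n$-ary) such that the $\tau$-reduct of $\mathfrak A$ satisfies $\phi$ under the probabilistic team $\mathbb X$ with $f_{\mathbb X}=f^{\mathfrak A}$. $\mathcal L\le\mathcal L'$ means every $\phi\in\mathcal L$ has some $\phi'\in\mathcal L'$ with $\mathrm{Struc}_{d[0,1]}(\phi)=\mathrm{Struc}_{d[0,1]}(\phi')$;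 $\mathcal L<\mathcal L'$ means $\mathcal L\le\mathcal L'$ and not $\mathcal L'\le\mathcal L$. *)

(* Defs.v *)
From HB Require Import structures.
From mathcomp Require Import all_boot all_order all_algebra.
From mathcomp Require Import finmap.
From mathcomp Require Import reals.
Set Implicit Arguments. Unset Strict Implicit. Unset Printing Implicit Defensive.
Import Order.TTheory GRing.Theory Num.Theory.
Local Open Scope fset_scope.
Local Open Scope ring_scope.

Record vocab := Vocab { sym : Type; ar : sym -> nat }.

(** Formulas in negation normal form, first-order variables are nats.
    All atoms of both logics are included; sublogics are carved out below. *)
Inductive form (t : vocab) : Type :=
| FEq   (x y : nat)
| FNeq  (x y : nat)
| FRel  (r : sym t) (xs : seq nat)
| FNRel (r : sym t) (xs : seq nat)
| FDep  (xs : seq nat) (y : nat)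
| FMid  (xs ys : seq nat)
| FInd  (ys zs : seq nat)
| FAnd  (p q : form t)
| FOr   (p q : form t)
| FAll  (x : nat) (p : form t)
| FEx   (x : nat) (p : form t).

Arguments FEq {t}. Arguments FNeq {t}. Arguments FDep {t}.
Arguments FMid {t}. Arguments FInd {t}.

Fixpoint fv t (p : form t) : seq nat :=
  match p with
  | FEq x y | FNeq x y => [:: x; y]
  | FRel _ xs | FNRel _ xs => xs
  | FDep xs y => rcons xs y
  | FMid xs ys | FInd xs ys => xs ++ ys
  | FAnd p q | FOr p q => fv p ++ fv q
  | FAll x p | FEx x p => filter (predC1 x) (fv p)
  end.

Definition fvs t (p : form t) : seq nat := sort leq (undup (fv p)).
Definition fvD t (p : form t) : {fset nat} := [fset x | x in fvs p].

Fixpoint wf t (p : form t) : bool :=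
  match p with
  | FRel r xs | FNRel r xs => size xs == ar r
  | FMid xs ys => size xs == size ys
  | FAnd p q | FOr p q => wf p && wf q
  | FAll _ p | FEx _ p => wf p
  | _ => true
  end.

Fixpoint no_ind t (p : form t) : bool :=
  match p with
  | FInd _ _ => false
  | FAnd p q | FOr p q => no_ind p && no_ind q
  | FAll _ p | FEx _ p => no_ind p
  | _ => true
  end.

Fixpoint no_depmid t (p : form t) : bool :=
  match p with
  | FDep _ _ | FMid _ _ => false
  | FAnd p q | FOr p q => no_depmid p && no_depmid q
  | FAll _ p | FEx _ p => no_depmid p
  | _ => true
  end.

Definition FO_dep_mid t (p : form t) : bool := wf p && no_ind p.
Definition FO_ind t (p : form t) : bool := wf p && no_depmid p.

Section Semantics.
Variable R : realFieldType.
Variable t : vocab.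
Variable A : finType.
Variable I : forall r : sym t, pred ((ar r).-tuple A).

Definition sval (D : {fset nat}) (s : {ffun D -> A}) (x : nat) : option A :=
  omap s (insub x).

Definition vals (D : {fset nat}) (s : {ffun D -> A}) (xs : seq nat) : seq (option A) :=
  map (sval s) xs.

Definition vals_tot (D : {fset nat}) (s : {ffun D -> A}) (xs : seq nat) : option (seq A) :=
  if all (fun x => sval s x != None) xs then Some (pmap (sval s) xs) else None.

Definition to_tuple (n : nat) (a : seq A) : option (n.-tuple A) := insub a.

Definition rel_holds (D : {fset nat}) (s : {ffun D -> A}) (r : sym t) (xs : seq nat) : bool :=
  if vals_tot s xs is Some a then
    (if to_tuple (ar r) a is Some u then I u else false) else false.

Definition nrel_holds (D : {fset nat}) (s : {ffun D -> A}) (r : sym t) (xs : seq nat) : bool :=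
  if vals_tot s xs is Some a then
    (if to_tuple (ar r) a is Some u then ~~ I u else false) else false.

Definition mass (D : {fset nat}) (X : {ffun D -> A} -> R) (P : pred {ffun D -> A}) : R :=
  \sum_(s | P s) X s.

(** probabilistic team (the empty team is the zero function) *)
Definition isPT (D : {fset nat}) (X : {ffun D -> A} -> R) : Prop :=
  (forall s, 0 <= X s) /\ ((\sum_s X s = 1) \/ (forall s, X s = 0)).

Definition agree_but (x : nat) (D E : {fset nat}) (s : {ffun D -> A}) (u : {ffun E -> A}) : bool :=
  [forall v : D, (val v != x) ==> (sval u (val v) == Some (s v))].

Fixpoint sat (p : form t) (D : {fset nat}) (X : {ffun D -> A} -> R) {struct p} : Prop :=
  match p with
  | FEq x y => forall s, 0 < X s -> (sval s x != None) && (sval s x == sval s y)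
  | FNeq x y => forall s, 0 < X s ->
      [&& sval s x != None, sval s y != None & sval s x != sval s y]
  | FRel r xs => forall s, 0 < X s -> rel_holds s r xs
  | FNRel r xs => forall s, 0 < X s -> nrel_holds s r xs
  | FDep xs y => forall s s', 0 < X s -> 0 < X s' ->
      vals s xs = vals s' xs -> sval s y = sval s' y
  | FMid xs ys => forall a : seq A,
      mass X (fun s => vals s xs == map Some a) = mass X (fun s => vals s ys == map Some a)
  | FInd ys zs => forall b c : seq A,
      mass X (fun s => vals s ys == map Some b) * mass X (fun s => vals s zs == map Some c)
      = mass X (fun s => (vals s ys == map Some b) && (vals s zs == map Some c)) * mass X predT
  | FAnd p q => sat p X /\ sat q X
  | FOr p q => exists (Y Z : {ffun D -> A} -> R) (a : R),
      isPT Y /\ isPT Z /\ 0 <= a <= 1 /\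
      (forall s, X s = a * Y s + (1 - a) * Z s) /\ sat p Y /\ sat q Z
  | FAll x p =>
      sat p (fun u : {ffun (x |` D) -> A} =>
               (\sum_(s | agree_but x s u) X s) / #|A|%:R)
  | FEx x p => exists Y : {ffun (x |` D) -> A} -> R,
      isPT Y /\
      (forall u0 : {ffun (x |` D) -> A},
          \sum_(u | agree_but x u u0) Y u = \sum_(s | agree_but x s u0) X s) /\
      sat p Y
  end.

End Semantics.

(** d[0,1]-structures of vocabulary tau ∪ {f}, f of arity dn *)
Record dstruc (R : realFieldType) (t : vocab) := DStruc {
  dA : finType;
  dI : forall r : sym t, pred ((ar r).-tuple dA);
  dn : nat;
  df : dn.-tuple dA -> R }.

Definition is_distr (R : realFieldType) (A : finType) n (f : n.-tuple A -> R) : Prop :=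
  (forall a, 0 <= f a) /\ \sum_a f a = 1.

Definition team_of (R : realFieldType) t (p : form t) (M : dstruc R t)
  : {ffun fvD p -> dA M} -> R :=
  fun s => if vals_tot s (fvs p) is Some a then
             (if (insub a : option ((dn M).-tuple (dA M))) is Some u then df u else 0) else 0.

Definition InStruc (R : realFieldType) t (p : form t) (M : dstruc R t) : Prop :=
  (1 < #|dA M|)%N /\ is_distr (@df _ _ M) /\ dn M = size (fvs p) /\
  @sat R t (dA M) (@dI _ _ M) p (fvD p) (@team_of R t p M).

Definition equiv_form (R : realFieldType) t (p q : form t) : Prop :=
  forall M : dstruc R t, InStruc p M <-> InStruc q M.

Definition logic_le (R : realFieldType) (L L' : forall t, form t -> bool) : Prop :=
  forall (t : vocab) (p : form t), L t p ->
    exists q : form t, L' t q /\ equiv_form R p q.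

Definition logic_lt (R : realFieldType) (L L' : forall t, form t -> bool) : Prop :=
  logic_le R L L' /\ ~ logic_le R L' L.

(* Main.v *)
Require Import Defs.
From mathcomp Require Import all_boot all_order all_algebra finmap reals.
From mathcomp Require Import boolp ring lra.
(* Imported again because ssrfun's [sval] shadows the one of Defs. *)
Import Defs.

(** Both atoms are locally definable from marginal independence, so replacing them inside a
    formula gives the inclusion:
      dep(xs, y)  <->  forall us exists v ((us <> xs \/ v = y) /\ (v, us) _||_ (y, xs)),
      xs ~ ys     <->  forall a b exists zs (((a = b /\ zs = xs) \/ (a <> b /\ zs = ys))
                                             /\ zs _||_ (a, b)).
    For strictness, over a fixed finite structure the teams satisfying a formula of
    FO(dep, ~) form a finite union of convex cones: choosing a support for each dependence
    atom leaves only linear conditions.  Hence among the infinitely many product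
    distributions Ber(a) x Ber(a), a = 1, 1/2, 1/3, ..., two lie in the same cone, and their
    midpoint would satisfy x _||_ y, which it does not. *)

Set Implicit Arguments. Unset Strict Implicit. Unset Printing Implicit Defensive.
Import Order.TTheory GRing.Theory Num.Theory.
Local Open Scope fset_scope.
Local Open Scope ring_scope.

(** * Partial valuations, their updates and locality *)

Section Valuations.
Variable A : finType.
Implicit Types (g : nat -> option A) (P : pred nat).

(** Assignments are typed by their variable domain, which changes at a quantifier, so teams before
    and after it cannot be compared directly. Everything is therefore phrased through [expect X h],
    the integral of a function [h] of partial valuations of all variables, whatever the domain of
    [X]. A universal quantifier then averages [h] over the new variable, a Skolem witness
    substitutes its value into [h], and an arbitrary existential witness preserves the integrals of
    those [h] that ignore the new variable. These three rules reduce the correctness of both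
    translations to computations with expectations. For strictness, cones fit better than convex
    sets: the weights [a] and [1 - a] of a disjunction can be absorbed into its two halves, which
    leaves a plain sum of nonnegative functions. *)

Definition upd g x a : nat -> option A := fun y => if y == x then Some a else g y.

Lemma upd_neq g x a y : y != x -> upd g x a y = g y.
Proof. by rewrite /upd => /negbTE->. Qed.

Lemma upd_eq g x a : upd g x a x = Some a.
Proof. by rewrite /upd eqxx. Qed.

(** Semantic stand-in for a free-variable condition: [h] may read only variables in [P]. *)
Definition local_on (T : Type) P (h : (nat -> option A) -> T) :=
  forall g g', (forall y, P y -> g y = g' y) -> h g = h g'.

Lemma local_upd (T : Type) P (h : (nat -> option A) -> T) g x a :
  local_on P h -> ~~ P x -> h (upd g x a) = h g.
Proof.
by move=> hP xP; apply: hP => y yP; rewrite upd_neq //; apply: contraNneq xP => <-.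
Qed.

Lemma local_map P xs : all P xs -> local_on P (fun g => map g xs).
Proof. by move=> /allP xsP g g' e; apply/eq_in_map => y /xsP/e. Qed.

Fixpoint upds (F : nat -> (nat -> option A) -> A) zs g :=
  if zs is z :: zs then upds F zs (upd g z (F z g)) else g.

Lemma upds_notin F zs g y : y \notin zs -> upds F zs g y = g y.
Proof.
elim: zs g => [|z zs IH] g //=.
by rewrite inE negb_or => /andP[yz yzs]; rewrite IH // upd_neq.
Qed.

(** The updates run one after another, but Skolem functions that read nothing in [zs] cannot see the
    earlier ones, so the effect is simultaneous. *)
Lemma upds_in F zs g y : (forall z, local_on [predC zs] (F z)) ->
  y \in zs -> upds F zs g y = Some (F y g).
Proof.
elim: zs g => [|z zs IH] g //= loc.
have loc' z' : local_on [predC zs] (F z').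
  by move=> g1 g2 e; apply: loc => y'; rewrite /= inE negb_or => /andP[_ /e].
rewrite inE; have [yzs _|yzs] := boolP (y \in zs).
  rewrite IH //; congr Some; apply: loc => y'.
  by rewrite /= inE negb_or => /andP[/upd_neq->].
by rewrite orbF => /eqP yz; rewrite upds_notin // yz upd_eq.
Qed.

Lemma map_upds_notin F zs g ys :
  all [predC zs] ys -> map (upds F zs g) ys = map g ys.
Proof. by move=> /allP ysP; apply/eq_in_map => y /ysP/upds_notin->. Qed.

Lemma map_upds_in F zs g : (forall z, local_on [predC zs] (F z)) ->
  map (upds F zs g) zs = [seq Some (F z g) | z <- zs].
Proof. by move=> loc; apply/eq_in_map => y; apply: upds_in. Qed.

End Valuations.

(** * Assignments on finite domains seen as partial valuations *)

Section Assignments.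
Variable A : finType.

Lemma sval_val (D : {fset nat}) (s : {ffun D -> A}) (v : D) : sval s (val v) = Some (s v).
Proof. by rewrite /sval valK. Qed.

Lemma svalE (D : {fset nat}) (s : {ffun D -> A}) y (yD : y \in D) :
  sval s y = Some (s [` yD]).
Proof. exact: (sval_val s [` yD]). Qed.

Lemma sval_notin (D : {fset nat}) (s : {ffun D -> A}) y : y \notin D -> sval s y = None.
Proof. by move=> yD; rewrite /sval insubN. Qed.

Lemma sval_in (D : {fset nat}) (s : {ffun D -> A}) y : (sval s y != None) = (y \in D).
Proof.
have [yD|yD] := boolP (y \in D); last by rewrite sval_notin.
by rewrite /sval insubT.
Qed.

Lemma sval_inj (D : {fset nat}) (s s' : {ffun D -> A}) : sval s =1 sval s' -> s = s'.
Proof.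
by move=> e; apply/ffunP => v; apply: Some_inj; rewrite -!sval_val.
Qed.

(** The target domain [E] is a free parameter, equated with the extension of [D] by [x] only in the
    lemmas: extending twice by [x] gives an equal set but not a convertible type. Under that
    equation the default [a] of [odflt] is never reached. *)
Definition setv (D E : {fset nat}) x a (s : {ffun D -> A}) : {ffun E -> A} :=
  [ffun v => odflt a (upd (sval s) x a (val v))].

Lemma sval_setv (D E : {fset nat}) x a (s : {ffun D -> A}) : E = x |` D ->
  sval (setv E x a s) = upd (sval s) x a.
Proof.
move=> eE; apply: funext => y; have [yE|yE] := boolP (y \in E).
  rewrite svalE ffunE /= /upd.
  case: eqP yE => // /eqP yx; rewrite eE in_fset1U (negbTE yx) /= -(sval_in s).
  by case: sval.
rewrite sval_notin //; move: yE; rewrite eE in_fset1U negb_or => /andP[yx yD].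
by rewrite upd_neq // sval_notin.
Qed.

Lemma agree_butP (D E : {fset nat}) x (s : {ffun D -> A}) (u : {ffun E -> A}) :
  E = x |` D ->
  reflect (forall y, y != x -> sval u y = sval s y) (agree_but x s u).
Proof.
move=> eE; apply: (iffP forallP) => [h y yx|h v]; last first.
  by apply/implyP => vx; rewrite h // sval_val.
have [yD|yD] := boolP (y \in D).
  by have /implyP/(_ yx)/eqP-> := h [` yD]; rewrite svalE.
by rewrite !sval_notin // eE in_fset1U negb_or yx.
Qed.

Lemma setv_bij (R : nmodType) (D E : {fset nat}) x (s : {ffun D -> A})
    (k : {ffun E -> A} -> R) : E = x |` D ->
  \sum_(u | agree_but x s u) k u = \sum_a k (setv E x a s).
Proof.
move=> eE; have xE : x \in E by rewrite eE fset1U1.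
rewrite (reindex_onto (fun a => setv E x a s) (fun u : {ffun E -> A} => u [` xE])) /=.
  apply: eq_bigl => a; apply/andP; split.
    by apply/agree_butP => // y yx; rewrite sval_setv // upd_neq.
  by rewrite ffunE /= upd_eq.
move=> u /(agree_butP _ _ eE) h; apply: sval_inj => y; rewrite sval_setv //.
rewrite /upd; have [->|yx] := eqVneq y x; last by rewrite h.
by rewrite svalE.
Qed.

End Assignments.

(** * Expectations over teams and the effect of quantifiers on them *)

Section Teams.
Variables (R : realFieldType) (A : finType).
Hypothesis A_gt0 : (0 < #|A|)%N.
Implicit Types (D E : {fset nat}) (h k : (nat -> option A) -> R).

Let N_neq0 : #|A|%:R != 0 :> R.
Proof. by rewrite pnatr_eq0 -lt0n. Qed.

Definition expect D (X : {ffun D -> A} -> R) h := \sum_s X s * h (sval s).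

Lemma massE D (X : {ffun D -> A} -> R) (P : pred (nat -> option A)) :
  mass X (fun s => P (sval s)) = expect X (fun g => (P g)%:R).
Proof.
rewrite /mass big_mkcond; apply: eq_bigr => s _.
by case: (P _); rewrite ?mulr1 ?mulr0.
Qed.

Lemma mass_predT D (X : {ffun D -> A} -> R) : mass X predT = expect X (fun=> 1).
Proof. by apply: eq_bigr => s _; rewrite mulr1. Qed.

Lemma isPT_expect D (X : {ffun D -> A} -> R) :
  isPT X <-> (forall s, 0 <= X s) /\ (expect X (fun=> 1) = 1 \/ expect X (fun=> 1) = 0).
Proof.
have -> : expect X (fun=> 1) = \sum_s X s by apply: eq_bigr => s _; rewrite mulr1.
split=> -[X0 [X1|X1]]; split=> //; [by left| |by left|]; right.
  by rewrite big1.
by move=> s; apply: (psumr_eq0P _ X1).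
Qed.

Lemma isPT_ge0 D (X : {ffun D -> A} -> R) s : isPT X -> 0 <= X s.
Proof. by case. Qed.

Lemma eq_expect_supp D (X : {ffun D -> A} -> R) h k : isPT X ->
  (forall s, 0 < X s -> h (sval s) = k (sval s)) -> expect X h = expect X k.
Proof.
move=> XT e; apply: eq_bigr => s _.
have [->|X0] := eqVneq (X s) 0; first by rewrite !mul0r.
by rewrite e // lt0r X0 isPT_ge0.
Qed.

Lemma expect_gt0 D (X : {ffun D -> A} -> R) h s : isPT X ->
  (forall g, 0 <= h g) -> 0 < X s -> 0 < h (sval s) -> 0 < expect X h.
Proof.
move=> XT h0 Xs hs; rewrite /expect (bigD1 s) //= ltr_pwDl ?mulr_gt0 //.
by apply: sumr_ge0 => s' _; rewrite mulr_ge0 // isPT_ge0.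
Qed.

Lemma expect_gt0_supp D (X : {ffun D -> A} -> R) (P : pred (nat -> option A)) : isPT X ->
  0 < expect X (fun g => (P g)%:R) -> exists2 s, 0 < X s & P (sval s).
Proof.
move=> XT pos; apply: contrapT => noP; move: pos; rewrite (eq_expect_supp (k := fun=> 0)) //.
  by rewrite /expect big1 ?ltxx // => s _; rewrite mulr0.
move=> s Xs; case: (boolP (P _)) => // Ps; case: noP; by exists s.
Qed.

Lemma expect_eq0_supp D (X : {ffun D -> A} -> R) (P : pred (nat -> option A)) : isPT X ->
  expect X (fun g => (~~ P g)%:R) = 0 -> forall s, 0 < X s -> P (sval s).
Proof.
move=> XT e s Xs; apply: contraT => nP.
suff : 0 < expect X (fun g => (~~ P g)%:R) by rewrite e ltxx.
by apply: (expect_gt0 (s := s)) => //; rewrite nP ltr01.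
Qed.

Lemma expectZ D (X : {ffun D -> A} -> R) a h : expect X (fun g => a * h g) = a * expect X h.
Proof. by rewrite /expect mulr_sumr; apply: eq_bigr => s _; rewrite mulrCA. Qed.

Lemma expectD D (X : {ffun D -> A} -> R) h k :
  expect X (fun g => h g + k g) = expect X h + expect X k.
Proof. by rewrite /expect -big_split; apply: eq_bigr => s _; rewrite mulrDr. Qed.

Definition all_team x D (X : {ffun D -> A} -> R) : {ffun (x |` D) -> A} -> R :=
  fun u => (\sum_(s | agree_but x s u) X s) / #|A|%:R.

Arguments all_team x {D} X u.

Definition same_marginal x D (X : {ffun D -> A} -> R) (Y : {ffun (x |` D) -> A} -> R) :=
  forall u0 : {ffun (x |` D) -> A},
    \sum_(u | agree_but x u u0) Y u = \sum_(s | agree_but x s u0) X s.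

Arguments same_marginal x {D} X Y.

(** Exchange of summation: each [s] contributes exactly to the assignments obtained from it by
    resetting [x]. Keeping [E] abstract also covers the case where [x] already lies in the
    domain. *)
Lemma agree_sum D E x (X : {ffun D -> A} -> R) h : E = x |` D ->
  \sum_(u : {ffun E -> A}) (\sum_(s | agree_but x s u) X s) * h (sval u)
  = expect X (fun g => \sum_a h (upd g x a)).
Proof.
move=> eE; under eq_bigr do rewrite mulr_suml.
rewrite (exchange_big_dep xpredT) //=; apply: eq_bigr => s _.
rewrite -mulr_sumr (setv_bij _ (fun u => h (sval u)) eE).
by congr (_ * _); apply: eq_bigr => a _; rewrite sval_setv.
Qed.

Lemma expect_all_team x D (X : {ffun D -> A} -> R) h :
  expect (all_team x X) h = expect X (fun g => (#|A|%:R)^-1 * \sum_a h (upd g x a)).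
Proof.
rewrite expectZ -(agree_sum _ _ erefl) mulr_sumr; apply: eq_bigr => u _.
by rewrite /all_team [_ / _]mulrC mulrA.
Qed.

Lemma sum_local_upd x h g : local_on (predC1 x) h ->
  \sum_a h (upd g x a) = #|A|%:R * h g.
Proof.
move=> loc; rewrite (eq_bigr (fun=> h g)); last first.
  by move=> a _; rewrite (local_upd _ _ loc) //= eqxx.
by rewrite sumr_const mulr_natl cardT -cardE.
Qed.

Lemma all_team_isPT x D (X : {ffun D -> A} -> R) : isPT X -> isPT (all_team x X).
Proof.
move=> XT; apply/isPT_expect; split.
  by move=> u; rewrite divr_ge0 ?ler0n ?sumr_ge0 // => s _; apply: isPT_ge0.
rewrite expect_all_team (_ : (fun g => _) = (fun=> 1)); first by case/isPT_expect: XT.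
by apply: funext => g; rewrite sumr_const cardT -cardE mulVf.
Qed.

Lemma expect_same_marginal x D (X : {ffun D -> A} -> R) Y h :
  same_marginal x X Y -> local_on (predC1 x) h -> expect Y h = expect X h.
Proof.
(* Scaling by [#|A|] turns [h], which is constant along [x], into a sum over all values of [x]; in
   that form both sides are sums over the marginals. *)
move=> XY loc; apply: (mulfI N_neq0); rewrite -!expectZ.
have xxD : x |` D = x |` (x |` D) by rewrite fsetUA fsetUid.
have e (Z : {fset nat}) (W : {ffun Z -> A} -> R) :
    expect W (fun g => #|A|%:R * h g) = expect W (fun g => \sum_a h (upd g x a)).
  by apply: eq_bigr => s _; rewrite sum_local_upd.
by rewrite !e -(agree_sum _ _ xxD) -(agree_sum _ _ erefl); apply: eq_bigr => u _; rewrite XY.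
Qed.

Lemma same_marginal_isPT x D (X : {ffun D -> A} -> R) Y : isPT X ->
  (forall u, 0 <= Y u) -> same_marginal x X Y -> isPT Y.
Proof.
move=> /isPT_expect[_ X1] Y0 XY; apply/isPT_expect; split=> //.
by rewrite (expect_same_marginal XY).
Qed.

(** Push-forward of [X] along a Skolem function: the witness team of an existential quantifier whose
    value is determined by the assignment. *)
Definition push_team x (F : (nat -> option A) -> A) D (X : {ffun D -> A} -> R) :
    {ffun (x |` D) -> A} -> R :=
  fun u => \sum_(s | setv (x |` D) x (F (sval s)) s == u) X s.

Arguments push_team x F {D} X u.

Lemma expect_push_team x F D (X : {ffun D -> A} -> R) h :
  expect (push_team x F X) h = expect X (fun g => h (upd g x (F g))).
Proof.
rewrite /expect; under eq_bigr do rewrite mulr_suml.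
rewrite (exchange_big_dep xpredT) //=; apply: eq_bigr => s _.
rewrite (big_pred1 (setv (x |` D) x (F (sval s)) s)) ?sval_setv //.
Qed.

Lemma push_team_isPT x F D (X : {ffun D -> A} -> R) : isPT X -> isPT (push_team x F X).
Proof.
move=> XT; apply/isPT_expect; rewrite expect_push_team; case/isPT_expect: (XT) => _; split=> //.
by move=> u; apply: sumr_ge0 => s _; apply: isPT_ge0.
Qed.

Lemma push_team_marginal x F D (X : {ffun D -> A} -> R) : same_marginal x X (push_team x F X).
Proof.
move=> u0; rewrite (exchange_big_dep xpredT) //= [RHS]big_mkcond; apply: eq_bigr => s _.
set r := setv _ _ _ _.
have e u : agree_but x u u0 && (r == u) = (u == r) && agree_but x s u0.
  rewrite andbC eq_sym; case: eqP => //= ->.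
  have xxD : x |` D = x |` (x |` D) by rewrite fsetUA fsetUid.
  by apply/(agree_butP _ _ xxD)/agree_butP => // + y yx => /(_ y yx)->;
    rewrite sval_setv // upd_neq.
rewrite (eq_bigl _ _ e); case: (agree_but x s u0); last first.
  by rewrite big_pred0 // => u; rewrite andbF.
by rewrite (big_pred1 r) // => u; rewrite andbT.
Qed.

(** Iterated averaging operator dual to [all_team]; for distinct [us] it is the expectation over
    independent uniform values of [us]. *)
Fixpoint avg us h g : R :=
  if us is u :: us then (#|A|%:R)^-1 * \sum_a avg us h (upd g u a) else h g.

Lemma eq_avg us h k g :
  (forall g', (forall y, y \notin us -> g' y = g y) -> h g' = k g') ->
  avg us h g = avg us k g.
Proof.
elim: us g => [|u us IH] g e /=; first exact: e.
congr (_ * _); apply: eq_bigr => a _; apply: IH => g' e'; apply: e => y.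
by rewrite inE negb_or => /andP[yu /e'->]; rewrite upd_neq.
Qed.

Lemma avg_const us c g : avg us (fun=> c) g = c.
Proof.
elim: us g => //= u us IH g; under eq_bigr do rewrite IH.
by rewrite sumr_const cardT -cardE -[c *+ _]mulr_natl mulKf.
Qed.

Lemma avgD us h k g : avg us (fun g => h g + k g) g = avg us h g + avg us k g.
Proof.
elim: us g => //= u us IH g; under eq_bigr do rewrite IH.
by rewrite big_split mulrDr.
Qed.

(** A factor that does not read [us] is a constant for the average. This is how the independence of
    quantified variables from the team enters. *)
Lemma avgM us h k g : local_on [predC us] k ->
  avg us (fun g => h g * k g) g = avg us h g * k g.
Proof.
elim: us g => //= u us IH g loc.
have loc' : local_on [predC us] k.
  by move=> g1 g2 e; apply: loc => y'; rewrite /= inE negb_or => /andP[_ /e].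
under eq_bigr do rewrite IH // (local_upd _ _ loc) ?inE ?eqxx //.
by rewrite -mulr_suml mulrA.
Qed.

(** Averaging consumes the variables [us]. For empty [P] the average no longer depends on the
    starting valuation at all, so any base such as [fun=> None] may be used. *)
Lemma avg_local P us h : local_on (predU P (mem us)) h -> local_on P (avg us h).
Proof.
elim: us P => [|u us IH] P loc g g' e /=.
  by apply: loc => y /= /orP[/e|].
congr (_ * _); apply: eq_bigr => a _.
apply: (IH (predU P (pred1 u))).
  move=> g1 g2 e'; apply: loc => y yP; apply: e'; move: yP.
  by rewrite /= !inE orbA.
by move=> y; rewrite /upd /=; case: eqP => //=; rewrite orbF => _ /e.
Qed.

Lemma avg_ge0 us h g : (forall g, 0 <= h g) -> 0 <= avg us h g.
Proof.
move=> h0; elim: us g => //= u us IH g; rewrite mulr_ge0 ?invr_ge0 ?ler0n //.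
exact: sumr_ge0.
Qed.

Lemma avg_gt0 us h g F : (forall g, 0 <= h g) -> 0 < h (upds F us g) -> 0 < avg us h g.
Proof.
move=> h0; elim: us g => //= u us IH g /IH pos; rewrite mulr_gt0 ?invr_gt0 ?ltr0n //.
by rewrite (bigD1 (F u g)) //= ltr_pwDl // sumr_ge0 // => a _; apply: avg_ge0.
Qed.

End Teams.

Arguments all_team {R A} x {D} X u.
Arguments same_marginal {R A} x {D} X Y.
Arguments push_team {R A} x F {D} X u.

(** * Normalising a decomposition of a team *)

Section FlatTeams.
Variables (R : realFieldType) (A : finType) (D : {fset nat}).
Implicit Types (X Y Z : {ffun D -> A} -> R).

(** A null [X] is no exception: the inverse of [0] is [0], and the result is the empty team. *)
Lemma isPT_scale X : (forall s, 0 <= X s) -> isPT (fun s => (\sum_s X s)^-1 * X s).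
Proof.
move=> X0; have S0 : 0 <= \sum_s X s by apply: sumr_ge0.
split=> [s|]; first by rewrite mulr_ge0 ?invr_ge0.
have [e|n0] := eqVneq (\sum_s X s) 0; last by left; rewrite -mulr_sumr mulVf.
by right=> s; rewrite e invr0 mul0r.
Qed.

(** Brings a plain sum into the weighted form demanded by disjunction: [a] is the mass of [Y], while
    [c] and [d] are the inverse masses of the parts; for an empty [X] all three are [0]. The parts
    are only rescaled, so support conditions and cone membership survive. *)
Lemma isPT_split X Y Z : isPT X -> (forall s, 0 <= Y s) -> (forall s, 0 <= Z s) ->
  (forall s, X s = Y s + Z s) ->
  exists2 a, 0 <= a <= 1 & exists c d, [/\ 0 <= c, 0 <= d,
    isPT (fun s => c * Y s), isPT (fun s => d * Z s) &
    forall s, X s = a * (c * Y s) + (1 - a) * (d * Z s)].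
Proof.
move=> [X0 X1] Y0 Z0 XYZ.
have cancel (W : {ffun D -> A} -> R) s : (forall s, 0 <= W s) ->
    (\sum_s W s) * ((\sum_s W s)^-1 * W s) = W s.
  move=> W0; have [e|n0] := eqVneq (\sum_s W s) 0; last by rewrite mulVKf.
  by rewrite (psumr_eq0P _ e) ?mulr0.
have SY : 0 <= \sum_s Y s by apply: sumr_ge0.
have SZ : 0 <= \sum_s Z s by apply: sumr_ge0.
case: X1 => [X1|X1].
  have SYZ : \sum_s Y s + \sum_s Z s = 1.
    by rewrite -big_split -X1; apply: eq_bigr => s _; rewrite XYZ.
  exists (\sum_s Y s); first by apply/andP; split; lra.
  exists (\sum_s Y s)^-1, (\sum_s Z s)^-1; split; rewrite ?invr_ge0 //;
    try exact: isPT_scale.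
  move=> s; rewrite (_ : 1 - \sum_s Y s = \sum_s Z s); last by lra.
  by rewrite !cancel.
have YZ0 s : Y s = 0 /\ Z s = 0.
  by have := XYZ s; rewrite X1 => e; have := Y0 s; have := Z0 s; split; lra.
exists 0; first by rewrite lexx ler01.
exists 0, 0; split => // [||s]; last by rewrite X1 !mul0r mulr0 addr0.
all: by split => [s|]; [rewrite mul0r|right=> s; rewrite mul0r].
Qed.

End FlatTeams.

(** * Flat formulas and blocks of quantifiers *)

Section Formulas.
Variables (R : realFieldType) (t : vocab) (A : finType).
Variable I : forall r : sym t, pred ((ar r).-tuple A).
Implicit Types (p q : form t).

Definition flat (D : {fset nat}) p (P : pred {ffun D -> A}) :=
  forall X : {ffun D -> A} -> R, isPT X -> (sat I p X <-> forall s, 0 < X s -> P s).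

Lemma flat_and (D : {fset nat}) p q (P Q : pred {ffun D -> A}) :
  flat p P -> flat q Q -> flat (FAnd p q) (predI P Q).
Proof.
move=> pP qQ X XT /=; rewrite pP // qQ //; split=> [[h1 h2] s Xs|h].
  by rewrite h1 ?h2.
by split=> s /h/andP[].
Qed.

Lemma flat_or (D : {fset nat}) p q (P Q : pred {ffun D -> A}) :
  flat p P -> flat q Q -> flat (FOr p q) (predU P Q).
Proof.
move=> pP qQ X XT /=; split=> [[Y [Z [a [YT [ZT [/andP[a0 a1] [XYZ [pY qZ]]]]]]]] s Xs|h].
  have Y0 := isPT_ge0 s YT; have Z0 := isPT_ge0 s ZT.
  have [Ys|Ys] := boolP (0 < Y s); first by rewrite ((pP _ YT).1 pY).
  have [Zs|Zs] := boolP (0 < Z s); first by rewrite ((qQ _ ZT).1 qZ) ?orbT.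
  have Ys0 : Y s = 0 by apply/eqP; rewrite eq_le Y0 leNgt Ys.
  have Zs0 : Z s = 0 by apply/eqP; rewrite eq_le Z0 leNgt Zs.
  by move: Xs; rewrite XYZ Ys0 Zs0 !mulr0 addr0 ltxx.
have X0 s : 0 <= X s by apply: isPT_ge0.
pose Y s := if P s then X s else 0; pose Z s := if P s then 0 else X s.
have Y0 s : 0 <= Y s by rewrite /Y; case: ifP.
have Z0 s : 0 <= Z s by rewrite /Z; case: ifP.
have XYZ s : X s = Y s + Z s by rewrite /Y /Z; case: ifP; rewrite ?addr0 ?add0r.
have [a a01 [c [d [c0 d0 YT ZT {}XYZ]]]] := isPT_split XT Y0 Z0 XYZ.
exists (fun s => c * Y s), (fun s => d * Z s), a.
split; [exact: YT|split; [exact: ZT|do 2![split=> //]; split]].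
  by apply/pP => // s; rewrite /Y; case: (P s); rewrite ?mulr0 ?ltxx.
apply/qQ => // s; rewrite /Z; case: (boolP (P s)) => Ps; first by rewrite mulr0 ltxx.
move=> dX; have Xs : 0 < X s.
  by rewrite lt0r X0 andbT; apply: contraTneq dX => ->; rewrite mulr0 ltxx.
by have := h s Xs; rewrite /= (negbTE Ps).
Qed.


Lemma flat_eq (D : {fset nat}) x y : x \in D ->
  flat (FEq x y) (fun s : {ffun D -> A} => sval s x == sval s y).
Proof.
by move=> xD X _ /=; split=> h s /h; rewrite sval_in xD.
Qed.

Lemma flat_neq (D : {fset nat}) x y : x \in D -> y \in D ->
  flat (FNeq x y) (fun s : {ffun D -> A} => sval s x != sval s y).
Proof.
by move=> xD yD X _ /=; split=> h s /h; rewrite !sval_in xD yD.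
Qed.

Lemma flat_ext (D : {fset nat}) p (P Q : pred {ffun D -> A}) :
  P =1 Q -> flat p P -> flat p Q.
Proof. by move=> PQ pP X /pP->; split=> h s /h; rewrite PQ. Qed.

(** The tail [p] is the base case of the fold: the syntax has no constants for truth and falsity
    with which to end a conjunction or, in [neqs], a disjunction. *)
Definition eqs (xs ys : seq nat) p :=
  foldr (fun c acc => FAnd (FEq c.1 c.2) acc) p (zip xs ys).

Definition neqs (xs ys : seq nat) p :=
  foldr (fun c acc => FOr (FNeq c.1 c.2) acc) p (zip xs ys).

Lemma flat_eqs (D : {fset nat}) xs ys p (P : pred {ffun D -> A}) :
  size xs = size ys -> {subset xs <= D} -> flat p P ->
  flat (eqs xs ys p) (fun s => (map (sval s) xs == map (sval s) ys) && P s).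
Proof.
move=> + + pP; elim: xs ys => [|x xs IH] [|y ys] //= [sz] xsD.
apply: (@flat_ext _ _ _ _ _ (flat_and (@flat_eq _ _ y (xsD x _)) (IH ys sz _))).
- by move=> s /=; rewrite eqseq_cons andbA.
- exact: mem_head.
by move=> z zs; apply: xsD; rewrite inE zs orbT.
Qed.

Lemma flat_neqs (D : {fset nat}) xs ys p (P : pred {ffun D -> A}) :
  size xs = size ys -> {subset xs <= D} -> {subset ys <= D} -> flat p P ->
  flat (neqs xs ys p) (fun s => (map (sval s) xs != map (sval s) ys) || P s).
Proof.
move=> + + + pP; elim: xs ys => [|x xs IH] [|y ys] //= [sz] xsD ysD.
apply: (@flat_ext _ _ _ _ _ (flat_or (flat_neq (xsD x _) (ysD y _)) (IH ys sz _ _))).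
- by move=> s /=; rewrite eqseq_cons negb_and orbA.
- exact: mem_head.
- exact: mem_head.
- by move=> z zs; apply: xsD; rewrite inE zs orbT.
by move=> z zs; apply: ysD; rewrite inE zs orbT.
Qed.

Definition alls (us : seq nat) p := foldr (@FAll t) p us.
Definition exs (us : seq nat) p := foldr (@FEx t) p us.

Hypothesis A_gt0 : (0 < #|A|)%N.

(** Only the membership predicate of the new domain and the expectations of the new team matter
    later, so the nested extension is hidden behind an existential. *)
Lemma sat_alls us p (D : {fset nat}) (X : {ffun D -> A} -> R) : isPT X ->
  exists (D' : {fset nat}) (X' : {ffun D' -> A} -> R), [/\ isPT X',
    forall y, (y \in D') = (y \in us) || (y \in D),
    sat I (alls us p) X <-> sat I p X' &
    forall h, expect X' h = expect X (avg us h)].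
Proof.
elim: us D X => [|u us IH] D X XT; first by exists D, X.
have [D' [X' [X'T D'E satE expE]]] := IH _ _ (all_team_isPT A_gt0 u XT).
exists D', X'; split=> //.
- by move=> y; rewrite D'E !inE orbCA orbA.
- by move=> h; rewrite expE expect_all_team.
Qed.

(** Skolem functions yield a sufficient condition with all expectations known. In the other
    direction, [sat_exsE] has to cope with an arbitrary witness and controls only expectations that
    ignore [zs]. *)
Lemma sat_exs_push F zs p (D : {fset nat}) (X : {ffun D -> A} -> R) : isPT X ->
  exists (D' : {fset nat}) (X' : {ffun D' -> A} -> R), [/\ isPT X',
    forall y, (y \in D') = (y \in zs) || (y \in D),
    sat I p X' -> sat I (exs zs p) X &
    forall h, expect X' h = expect X (fun g => h (upds F zs g))].
Proof.
elim: zs D X => [|z zs IH] D X XT; first by exists D, X.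
have [D' [X' [X'T D'E satE expE]]] := IH _ _ (push_team_isPT z (F z) XT).
exists D', X'; split=> //.
- by move=> y; rewrite D'E !inE orbCA orbA.
- move=> /satE pY; exists (push_team z (F z) X); split; first exact: push_team_isPT.
  by split=> //; apply: push_team_marginal.
- by move=> h; rewrite expE expect_push_team.
Qed.

Lemma sat_exsE zs p (D : {fset nat}) (X : {ffun D -> A} -> R) : isPT X ->
  sat I (exs zs p) X ->
  exists (D' : {fset nat}) (X' : {ffun D' -> A} -> R), [/\ isPT X',
    forall y, (y \in D') = (y \in zs) || (y \in D), sat I p X' &
    forall h, local_on [predC zs] h -> expect X' h = expect X h].
Proof.
elim: zs D X => [|z zs IH] D X XT; first by move=> pX; exists D, X.
move=> [Y [YT [XY /(IH _ _ YT)[D' [X' [X'T D'E satE expE]]]]]].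
exists D', X'; split=> //.
  by move=> y; rewrite D'E !inE orbCA orbA.
move=> h loc; rewrite expE.
  apply: (expect_same_marginal A_gt0 XY).
  by move=> g g' e; apply: loc => y /=; rewrite inE negb_or => /andP[/e].
by move=> g g' e; apply: loc => y /=; rewrite inE negb_or => /andP[_ /e].
Qed.

End Formulas.

(** * Defining dependence and marginal identity by marginal independence *)

Section Translation.
Variables (R : realFieldType) (t : vocab).

Definition fresh (xs : seq nat) := (\max_(x <- xs) x).+1.

Arguments fresh : simpl never.

Lemma fresh_gt xs x : x \in xs -> (x < fresh xs)%N.
Proof. by move=> xxs; rewrite ltnS; apply: (@leq_bigmax_seq _ _ xpredT id). Qed.

(* If y = f(xs), then the witness is v = f(us) for the independent uniform copy us of xs. *)
Definition dep_tr (us : seq nat) v xs y : form t :=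
  alls us (FEx v (FAnd (neqs us xs (FEq v y)) (FInd (v :: us) (y :: xs)))).

(* The event a = b is independent of everything else, so zs is independent of (a, b) iff
   zs has the same law when it copies xs (a = b) as when it copies ys (a <> b). *)
Definition mid_tr a b (zs xs ys : seq nat) : form t :=
  alls [:: a; b] (exs zs (FAnd (FOr (eqs zs xs (FEq a b)) (eqs zs ys (FNeq a b)))
                               (FInd zs [:: a; b]))).

Variables (A : finType) (I : forall r : sym t, pred ((ar r).-tuple A)).
Hypothesis A_gt1 : (1 < #|A|)%N.
Let A_gt0 : (0 < #|A|)%N := ltnW A_gt1.

Definition ind xs (c : seq A) (g : nat -> option A) : R := (map g xs == map Some c)%:R.

Lemma ind_ge0 xs c g : 0 <= ind xs c g.
Proof. exact: ler0n. Qed.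

Lemma ind_local P xs c : all P xs -> local_on P (ind xs c).
Proof. by move=> xsP g g' e; rewrite /ind (local_map xsP e). Qed.

Lemma sat_FInd (D : {fset nat}) (X : {ffun D -> A} -> R) ys zs : sat I (FInd ys zs) X <->
  forall b c, expect X (ind ys b) * expect X (ind zs c) =
    expect X (fun g => ind ys b g * ind zs c g) * expect X (fun=> 1).
Proof.
have e b c : expect X (fun g => ind ys b g * ind zs c g) =
    mass X (fun s => (vals s ys == map Some b) && (vals s zs == map Some c)).
  rewrite (massE X (fun g => (map g ys == map Some b) && (map g zs == map Some c))).
  by apply: eq_bigr => s _; rewrite /ind -natrM mulnb.
have e1 xs b : expect X (ind xs b) = mass X (fun s => vals s xs == map Some b).
  by rewrite (massE X (fun g => map g xs == map Some b)).
by split=> h b c; have := h b c; rewrite e !e1 mass_predT.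
Qed.

(** Needed because atoms compare with tuples over [A], whereas valuations take values in
    [option A]. *)
Lemma vals_Some (D : {fset nat}) (s : {ffun D -> A}) xs : {subset xs <= D} ->
  exists c, map (sval s) xs = map Some c.
Proof.
elim: xs => [|x xs IH] xsD; first by exists [::].
have [|c ec] := IH; first by move=> z zs; rewrite xsD // inE zs orbT.
have xD : x \in D by rewrite xsD ?mem_head.
by exists (s [` xD] :: c); rewrite /= svalE ec.
Qed.

(** In one direction [v] is a function of the quantified [us] alone, hence independent of [(y, xs)].
    Conversely, let two supporting assignments both give [xs] the value [c], and give [y] the values
    [b] and [b']. The events [(v, us) = (b, c)] and [(y, xs) = (b', c)] have positive weight, hence
    by independence so does their intersection. There [us = xs], so the guard forces [v = y], that
    is [b = b']. *)
Lemma sat_dep_tr (D : {fset nat}) (X : {ffun D -> A} -> R) us v xs y :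
  isPT X -> {subset y :: xs <= D} -> uniq us -> size us = size xs ->
  v \notin us -> v \notin y :: xs -> all [predC us] (y :: xs) ->
  sat I (FDep xs y) X <-> sat I (dep_tr us v xs y) X.
Proof.
move=> XT yxD uus sz vus vyx yxus.
have [vy vxs] : v != y /\ v \notin xs.
  by move: vyx; rewrite inE negb_or => /andP.
have [yus xsus] : y \notin us /\ all [predC us] xs by move: yxus => /andP.
have xsD : {subset xs <= D} by move=> x xxs; rewrite yxD // inE xxs orbT.
have [D1 [X1 [X1T D1E sat1 exp1]]] :=
  sat_alls I A_gt0 us (FEx v (FAnd (neqs us xs (FEq v y)) (FInd (v :: us) (y :: xs)))) XT.
rewrite sat1.
pose G g := (map g us != map g xs) || (g v == g y :> option A).
have guard (D2 : {fset nat}) : (forall z, (z \in D2) = (z \in [:: v]) || (z \in D1)) ->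
    flat R I (neqs us xs (FEq v y)) (fun s : {ffun D2 -> A} => G (sval s)).
  move=> D2E; apply: flat_neqs => //.
  - by move=> z zus; rewrite D2E D1E zus orbT.
  - by move=> z zxs; rewrite D2E D1E xsD // !orbT.
  by apply: flat_eq; rewrite D2E mem_head.
split=> [dep|].
  have [a0 _] : exists a0 : A, a0 \in A by apply/card_gt0P.
  (* On a value [c] that [xs] never takes in the support, [f] falls back to [a0]; this is harmless,
     since for such values of [us] the guard holds through [us <> xs]. *)
  pose f c := odflt a0
    (if [pick s | (0 < X s) && (map (sval s) xs == c)] is Some s then sval s y else None).
  pose F (_ : nat) (g : nat -> option A) := f (map g us).
  have fP s : 0 < X s -> Some (f (map (sval s) xs)) = sval s y.
    move=> Xs; rewrite /f; case: pickP => [s' /andP[Xs' /eqP e]|/(_ s)]; last by rewrite Xs eqxx.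
    rewrite (dep s' s) //; have : sval s y != None by rewrite sval_in yxD ?mem_head.
    by case: (sval s y).
  have [D2 [Y [YT D2E satY expY]]] := sat_exs_push I F [:: v]
    (FAnd (neqs us xs (FEq v y)) (FInd (v :: us) (y :: xs))) X1T.
  apply: satY; split.
    apply/(guard D2 D2E) => //; apply: expect_eq0_supp => //.
    rewrite expY exp1 (eq_expect_supp (k := fun=> 0)) //.
      by rewrite /expect big1 // => s _; rewrite mulr0.
    move=> s Xs; rewrite -[RHS](avg_const A_gt0 us 0 (sval s)).
    apply: eq_avg => g e; rewrite /G /= upd_eq upd_neq 1?eq_sym //.
    have -> : map (upd g v (F v g)) us = map g us.
      apply: (@map_upds_notin _ F [:: v]); apply/allP => z.
      by rewrite /= inE; apply: contraTneq => ->.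
    have -> : map (upd g v (F v g)) xs = map (sval s) xs.
      rewrite (@map_upds_notin _ F [:: v]); last first.
        by apply/allP => z; rewrite /= inE; apply: contraTneq => ->.
      by apply/eq_in_map => z /(allP xsus)/e.
    by rewrite /F; case: eqP => //= <-; rewrite fP // e // eqxx.
  apply/sat_FInd => b c.
  have loc2 : local_on [predC us] (ind (y :: xs) c) by apply: ind_local.
  pose h g := ind (v :: us) b (upd g v (F v g)).
  have loch : local_on (mem us) h.
    move=> g g' e; rewrite /h /ind.
    have eF : F v g = F v g' by congr f; apply/eq_in_map.
    congr ((_ == _)%:R); apply/eq_in_map => z.
    by rewrite /upd eF inE; case: eqP => //= _ /e.
  (* The probability of [(v, us) = b] for uniform [us]; as [h] reads only [us], the base valuation
     is arbitrary. *)
  pose K := avg us h (fun=> None).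
  have avgh g : avg us h g = K.
    have loc : local_on pred0 (avg us h) by apply: avg_local.
    exact: loc.
  have e2 g : ind (y :: xs) c (upd g v (F v g)) = ind (y :: xs) c g.
    apply: (@local_upd _ _ (predC1 v)); last by rewrite /= eqxx.
    by apply: ind_local; apply/allP => z; rewrite /=; apply: contraTneq => ->.
  have -> : expect Y (ind (v :: us) b) = K * expect X (fun=> 1).
    by rewrite expY exp1 -expectZ; apply: eq_bigr => s _; rewrite mulr1 -(avgh (sval s)).
  have -> : expect Y (ind (y :: xs) c) = expect X (ind (y :: xs) c).
    rewrite expY exp1; apply: eq_bigr => s _; congr (_ * _).
    rewrite -[RHS]mul1r -[1](avg_const A_gt0 us 1 (sval s)) -avgM //.
    by apply: eq_avg => g _; rewrite mul1r /= e2.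
  have -> : expect Y (fun g => ind (v :: us) b g * ind (y :: xs) c g) =
      K * expect X (ind (y :: xs) c).
    rewrite expY exp1 -expectZ; apply: eq_bigr => s _; congr (_ * _).
    by rewrite -(avgh (sval s)) -avgM //; apply: eq_avg => g _; rewrite /= e2.
  have -> : expect Y (fun=> 1) = expect X (fun=> 1).
    by rewrite expY exp1; apply: eq_bigr => s _; rewrite avg_const.
  by rewrite mulrAC.
move=> /(sat_exsE (zs := [:: v]) A_gt0 X1T)[D2 [Y [YT D2E [/(guard D2 D2E _ YT) GY]]]].
move=> /sat_FInd indY expY s s' Xs Xs' e.
have [c ec] := vals_Some s xsD.
have [[|b []] //= [eb]] : exists b, map (sval s) [:: y] = map Some b.
  by apply: vals_Some => z; rewrite inE => /eqP->; rewrite yxD ?mem_head.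
have [[|b' []] //= [eb']] : exists b, map (sval s') [:: y] = map Some b.
  by apply: vals_Some => z; rewrite inE => /eqP->; rewrite yxD ?mem_head.
have [a0 _] : exists a0 : A, a0 \in A by apply/card_gt0P.
have szc : size us = size c by rewrite sz -(size_map (sval s)) ec size_map.
(* The event that [us] and [xs] equal [c] and [y] equals [b] does not mention [v], so its weight is
   known before [v] is chosen; the guard then forces [v = b] on it. *)
have pos1 : 0 < expect Y (ind (v :: us) (b :: c)).
  pose k g := ind us c g * ind (y :: xs) (b :: c) g.
  have le : expect Y k <= expect Y (ind (v :: us) (b :: c)).
    apply: ler_sum => r _; have [->|Yr] := eqVneq (Y r) 0; first by rewrite !mul0r.
    apply: ler_wpM2l; first exact: isPT_ge0.
    rewrite /k /ind -natrM mulnb ler_nat /= !eqseq_cons.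
    case: eqP => //= e1; case: eqP => //= e2; case: eqP => //= e3.
    have /GY : 0 < Y r by rewrite lt0r Yr isPT_ge0.
    by rewrite /G e1 e3 eqxx /= e2 => /eqP->; rewrite eqxx.
  apply: lt_le_trans le; rewrite expY; last first.
    move=> g g' e'; congr (_ * _); apply: ind_local e' => //.
      by apply/allP => z zus; rewrite /= inE; apply: contraTneq zus => ->.
    by apply/allP => z zyx; rewrite /= inE; apply: contraTneq zyx => ->.
  rewrite exp1; apply: (expect_gt0 (s := s)) => //.
    by move=> g; apply: avg_ge0 => g'; rewrite mulr_ge0 ?ind_ge0.
  apply: (avg_gt0 A_gt0 (F := fun z _ => nth a0 c (index z us))).
    by move=> g; rewrite mulr_ge0 ?ind_ge0.
  rewrite /k /ind map_upds_in // map_upds_notin // /= eb ec eqxx mulr1.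
  rewrite (_ : [seq _ | z <- us] = map Some c) ?eqxx ?ltr01 //.
  apply: (@eq_from_nth _ None); rewrite !size_map // => i lti.
  by rewrite (nth_map 0%N) // index_uniq // (nth_map a0) // -szc.
have pos2 : 0 < expect Y (ind (y :: xs) (b' :: c)).
  rewrite expY; last first.
    by apply: ind_local; apply/allP => z zyx; rewrite /= inE; apply: contraTneq zyx => ->.
  rewrite exp1.
  have -> : expect X (avg us (ind (y :: xs) (b' :: c))) = expect X (ind (y :: xs) (b' :: c)).
    apply: eq_bigr => r _; congr (_ * _).
    rewrite -[RHS]mul1r -[1](avg_const A_gt0 us 1 (sval r)) -avgM //; last exact: ind_local.
    by apply: eq_avg => g _; rewrite mul1r.
  apply: (expect_gt0 (s := s')) => //.
  by rewrite /ind /= eb' -[map _ xs]/(vals s' xs) -e /vals ec eqxx ltr01.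
pose J := expect Y (fun g => ind (v :: us) (b :: c) g * ind (y :: xs) (b' :: c) g).
have eJ := indY (b :: c) (b' :: c); rewrite -/J in eJ.
have J_gt0 : 0 < J.
  have : 0 < J * expect Y (fun=> 1) by rewrite -eJ mulr_gt0.
  have [_ [->|->]] := (isPT_expect Y).1 YT; first by rewrite mulr1.
  by rewrite mulr0 ltxx.
have [|r Yr] := @expect_gt0_supp _ _ _ Y
   (fun g => (map g (v :: us) == map Some (b :: c)) && (map g (y :: xs) == map Some (b' :: c))) YT.
  by rewrite /J /ind in J_gt0; under eq_fun do rewrite -mulnb natrM.
rewrite /= !eqseq_cons => /andP[/andP[/eqP e1 /eqP e2] /andP[/eqP e3 /eqP e4]].
by have := GY r Yr; rewrite /G e2 e4 eqxx /= e1 e3 eb eb' => /eqP.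
Qed.

(** Every value [(d0, d1)] of [(a, b)] has positive probability, so under independence the law of
    [zs] can be read off conditionally on any single one. A diagonal value gives the law of [xs], an
    off-diagonal one that of [ys]; the latter exists because [A] has two elements. *)
Lemma sat_mid_tr (D : {fset nat}) (X : {ffun D -> A} -> R) a b zs xs ys :
  isPT X -> {subset xs <= D} -> {subset ys <= D} ->
  size xs = size ys -> size zs = size xs -> uniq zs -> a != b ->
  all [predC zs] [:: a; b] ->
  all [predC zs] xs -> all [predC zs] ys ->
  all [predC [:: a; b]] xs -> all [predC [:: a; b]] ys ->
  sat I (FMid xs ys) X <-> sat I (mid_tr a b zs xs ys) X.
Proof.
move=> XT xsD ysD sxy szx uzs ab abzs xszs yszs xsab ysab.
pose us := [:: a; b].
pose body : form t := FAnd (FOr (eqs zs xs (FEq a b)) (eqs zs ys (FNeq a b))) (FInd zs us).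
have [D1 [X1 [X1T D1E sat1 exp1]]] := sat_alls I A_gt0 us (exs zs body) XT.
rewrite [mid_tr _ _ _ _ _]/(alls us (exs zs body)) sat1.
have satX : sat I (FMid xs ys) X <-> forall c, expect X (ind xs c) = expect X (ind ys c).
  have e1 ws c : expect X (ind ws c) = mass X (fun s => vals s ws == map Some c).
    by rewrite (massE X (fun g => map g ws == map Some c)).
  by split=> h c; have := h c; rewrite !e1.
rewrite {}satX.
pose pick (e : bool) := if e then xs else ys.
have pickD e : {subset pick e <= D} by case: e.
have pickzs e : all [predC zs] (pick e) by case: e.
have pickab e : all [predC us] (pick e) by case: e.
have szp e : size zs = size (pick e) by case: e; rewrite szx.
pose G g := map g zs == map (g : nat -> option A) (pick (g a == g b)).
have guard (D2 : {fset nat}) : (forall z, (z \in D2) = (z \in zs) || (z \in D1)) ->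
    flat R I (FOr (eqs zs xs (FEq a b)) (eqs zs ys (FNeq a b)))
      (fun s : {ffun D2 -> A} => G (sval s)).
  move=> D2E; have zsD : {subset zs <= D2} by move=> z zzs; rewrite D2E zzs.
  have aD : a \in D2 by rewrite D2E D1E mem_head orbT.
  have bD : b \in D2 by rewrite D2E D1E !inE eqxx !orbT.
  have flat1 := flat_eqs szx zsD (@flat_eq R _ _ I _ _ b aD).
  have flat2 := flat_eqs (etrans szx sxy) zsD (@flat_neq R _ _ I _ _ _ aD bD).
  refine (flat_ext _ (flat_or flat1 flat2)).
  by move=> s; rewrite /G /=; case: (sval s a == sval s b); rewrite ?andbT ?andbF ?orbF.
have indab d0 d1 g : ind us [:: d0; d1] g != 0 -> (g a == g b) = (d0 == d1).
  by rewrite /ind pnatr_eq0 eqb0 negbK => /eqP[-> ->]; rewrite (inj_eq Some_inj).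
have indP e c : local_on [predC us] (ind (pick e) c) by apply: ind_local.
have avg_ind d g : avg us (ind us d) g = avg us (ind us d) (fun=> None).
  have loc : local_on pred0 (avg us (ind us d)).
    by apply: avg_local; apply: ind_local; apply/allP.
  exact: loc.
have [a0 [b0 [_ _ ab0]]] := card_gt1P A_gt1.
split=> [mid|].
  (* The default [a] of [nth] lies outside [zs], so [F z] stays local even for a [z] that is not in
     [zs]. *)
  pose F z (g : nat -> option A) := odflt a0 (g (nth a (pick (g a == g b)) (index z zs))).
  have Floc z : local_on [predC zs] (F z).
    move=> g g' e; rewrite /F; have /and3P[az bz _] := abzs.
    rewrite (e a) // (e b) //; congr odflt; apply: e; set ws := pick _.
    have [lti|] := ltnP (index z zs) (size ws); last by move=> ?; rewrite nth_default.
    by apply: (allP (pickzs _)); apply: mem_nth.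
  have [D2 [Y [YT D2E satY expY]]] := sat_exs_push I F zs body X1T.
  have Fzs g s : (forall y, y \notin us -> g y = sval s y) ->
      map (upds F zs g) zs = map (sval (s : {ffun D -> A})) (pick (g a == g b)).
    move=> e; rewrite map_upds_in //; set ws := pick _.
    apply: (@eq_from_nth _ None); rewrite !size_map; first exact: szp.
    move=> i lti'; have lti : (i < size ws)%N by rewrite -(szp (g a == g b)).
    rewrite (nth_map 0%N) // (nth_map a) // /F index_uniq // -/ws.
    have wsi : nth a ws i \in ws by apply: mem_nth.
    rewrite e; last exact: (allP (pickab _) _ wsi).
    have := sval_in s (nth a ws i); rewrite (pickD _ _ wsi).
    by case: (sval s _).
  have indF g s c : (forall y, y \notin us -> g y = sval s y) ->
      ind zs c (upds F zs g) = ind (pick (g a == g b)) c (sval (s : {ffun D -> A})).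
    by move=> e; rewrite /ind (Fzs g s).
  have upds_us g d : ind us d (upds F zs g) = ind us d g.
    by rewrite /ind map_upds_notin.
  apply: satY; split.
    apply/(guard D2 D2E) => //; apply: expect_eq0_supp => //.
    rewrite expY exp1 /expect big1 // => s _.
    rewrite (eq_avg (k := fun=> 0)) ?avg_const ?mulr0 // => g e.
    rewrite /G (Fzs g s) // !upds_notin; try by case/and3P: abzs.
    rewrite map_upds_notin // (_ : map g _ = map (sval s) (pick (g a == g b))) ?eqxx //.
    by apply/eq_in_map => z zp; apply: e; apply: (allP (pickab _) _ zp).
  apply/sat_FInd => c d.
  have midp e : expect X (ind (pick e) c) = expect X (ind xs c) by case: e; rewrite //= mid.
  pose eq_ab (g : nat -> option A) : R := (g a == g b)%:R.
  have avg_eq (h : (nat -> option A) -> R) g : local_on (mem us) h ->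
      avg us h g = avg us h (fun=> None).
    move=> loch; have loc : local_on pred0 (avg us h) by apply: avg_local.
    exact: loc.
  have loc_ab : local_on (mem us) eq_ab.
    by move=> g g' e; rewrite /eq_ab !e //= !inE eqxx ?orbT.
  have loc_nab : local_on (mem us) (fun g => 1 - eq_ab g).
    by move=> g g' e; rewrite (loc_ab g g' e).
  pose p := avg us eq_ab (fun=> None); pose q := avg us (fun g => 1 - eq_ab g) (fun=> None).
  have pq : p + q = 1.
    rewrite /p /q -avgD -[RHS](avg_const A_gt0 us 1 (fun=> None)).
    by apply: eq_avg => g _; rewrite addrC subrK.
  (* The law of [zs] is the mixture of the laws of [xs] and [ys] with weights [p] and [q]; these
     laws coincide and the weights add up to [1]. *)
  have -> : expect Y (ind zs c) = expect X (ind xs c).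
    rewrite -[RHS]mul1r -pq mulrDl -{2}(midp false) -!expectZ -expectD expY exp1.
    apply: eq_bigr => s _; congr (_ * _).
    rewrite [p](esym (avg_eq _ (sval s) loc_ab)) [q](esym (avg_eq _ (sval s) loc_nab)) -!avgM //.
      rewrite -avgD; apply: eq_avg => g e.
      have eg b' : ind (pick b') c (sval s) = ind (pick b') c g.
        by apply: indP => y yus; rewrite e.
      rewrite (indF _ s) // eg /eq_ab; case: (g a == g b);
        by rewrite ?subrr ?subr0 ?mul0r ?mul1r ?addr0 ?add0r.
    exact: (indP true).
  have -> : expect Y (ind us d) = avg us (ind us d) (fun=> None) * expect X (fun=> 1).
    rewrite expY exp1 -expectZ; apply: eq_bigr => s _; congr (_ * _).
    by rewrite mulr1 -(avg_ind _ (sval s)); apply: eq_avg => g _; rewrite upds_us.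
  have -> : expect Y (fun=> 1) = expect X (fun=> 1).
    by rewrite expY exp1; apply: eq_bigr => s _; rewrite avg_const.
  have -> : expect Y (fun g => ind zs c g * ind us d g) =
      avg us (ind us d) (fun=> None) * expect X (ind xs c).
    (* The atom is tested against sequences of every length; unless [d] has length two, its
       indicator vanishes. *)
    have [[d0 [d1 ->]]|ind0] : (exists d0 d1, d = [:: d0; d1]) \/ ind us d = fun=> 0.
    - case: d => [|d0 [|d1 [|d2 d]]]; [right|right|by left; exists d0, d1|right];
        by apply: funext => g; rewrite /ind /= ?eqseq_cons ?andbF.
    - rewrite -(midp (d0 == d1)) -expectZ expY exp1; apply: eq_bigr => s _; congr (_ * _).
      rewrite -(avg_ind _ (sval s)) -avgM //; apply: eq_avg => g e.
      rewrite upds_us mulrC.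
      have [->|n0] := eqVneq (ind us [:: d0; d1] g) 0; first by rewrite !mul0r.
      rewrite (indF _ s) // (indab _ _ _ n0); congr (_ * _).
      by apply: indP => y yus; rewrite e.
    rewrite ind0 avg_const // mul0r /expect big1 // => s _; by rewrite !mulr0.
  by rewrite mulrCA mulrA.
move=> /(sat_exsE A_gt0 X1T)[D2 [Y [YT D2E [/(guard D2 D2E _ YT) GY /sat_FInd indY] expY]]] c.
have [_ [X0|X0]] := XT; last by rewrite /expect !big1 // => s _; rewrite X0 mul0r.
have X1' : expect X (fun=> 1) = 1 by rewrite -[RHS]X0; apply: eq_bigr => s _; rewrite mulr1.
have Y1 : expect Y (fun=> 1) = 1.
  by rewrite expY // exp1 -[RHS]X1'; apply: eq_bigr => s _; rewrite avg_const.
(* Conditioning on [(a, b) = (d0, d1)]: independence makes the left side the same for all pairs,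
   while the guard identifies [zs] with the tuple chosen by [d0 == d1]. *)
have key (d0 d1 : A) : expect Y (ind zs c) = expect X (ind (pick (d0 == d1)) c).
  pose K := avg us (ind us [:: d0; d1]) (fun=> None).
  have K_gt0 : 0 < K.
    apply: (avg_gt0 A_gt0 (F := fun z _ => if z == a then d0 else d1)) => //.
    by rewrite /ind /= upd_eq upd_neq // upd_eq eqxx (eq_sym b a) (negbTE ab) eqxx ltr01.
  apply: (mulIf (lt0r_neq0 K_gt0)).
  have loc_us : local_on [predC zs] (ind us [:: d0; d1]) by apply: ind_local.
  have eK : expect Y (ind us [:: d0; d1]) = K.
    rewrite expY // exp1 -[RHS]mulr1 -X1' -expectZ.
    by apply: eq_bigr => s _; rewrite mulr1 avg_ind.
  have := indY c [:: d0; d1]; rewrite eK Y1 mulr1 => ->.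
  transitivity (expect Y (fun g => ind us [:: d0; d1] g * ind (pick (d0 == d1)) c g)).
    apply: eq_expect_supp => // s Ys; rewrite mulrC.
    have [->|n0] := eqVneq (ind us [:: d0; d1] (sval s)) 0; first by rewrite !mul0r.
    by congr (_ * _); rewrite /ind (eqP (GY s Ys)) (indab _ _ _ n0).
  rewrite expY; last first.
    by move=> g g' e; rewrite (loc_us g g' e) (ind_local _ (pickzs _) e).
  rewrite exp1 mulrC -expectZ; apply: eq_bigr => s _; congr (_ * _).
  by rewrite avgM // avg_ind.
have := key a0 a0; rewrite eqxx => <-; rewrite (key a0 b0).
by rewrite (negbTE ab0).
Qed.

End Translation.

(** * The translation of whole formulas *)

Section Equivalence.
Variables (R : realFieldType) (t : vocab).
Implicit Types p q : form t.

(** The auxiliary variables are fresh for the atom only. They may already occur in the domain of the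
    team; requantifying them just overwrites values that the atom does not read. *)
Fixpoint tr p : form t :=
  match p with
  | FDep xs y =>
      let m := fresh (y :: xs) in dep_tr t (iota m (size xs)) (m + size xs) xs y
  | FMid xs ys =>
      let m := fresh (xs ++ ys) in mid_tr t m m.+1 (iota m.+2 (size xs)) xs ys
  | FAnd p q => FAnd (tr p) (tr q)
  | FOr p q => FOr (tr p) (tr q)
  | FAll x p => FAll x (tr p)
  | FEx x p => FEx x (tr p)
  | _ => p
  end.

Lemma mem_fv_alls us p z : (z \in fv (alls us p)) = (z \notin us) && (z \in fv p).
Proof.
by elim: us => //= u us IH; rewrite mem_filter /= IH inE negb_or andbA.
Qed.

Lemma mem_fv_exs us p z : (z \in fv (exs us p)) = (z \notin us) && (z \in fv p).
Proof.
by elim: us => //= u us IH; rewrite mem_filter /= IH inE negb_or andbA.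
Qed.

Lemma mem_fv_eqs xs ys p z : size xs = size ys ->
  (z \in fv (eqs xs ys p)) = [|| z \in xs, z \in ys | z \in fv p].
Proof.
elim: xs ys => [|x xs IH] [|y ys] //= [/IH e]; rewrite !inE e.
by do ![case: (_ == _) | case: (_ \in _)].
Qed.

Lemma mem_fv_neqs xs ys p z : size xs = size ys ->
  (z \in fv (neqs xs ys p)) = [|| z \in xs, z \in ys | z \in fv p].
Proof.
elim: xs ys => [|x xs IH] [|y ys] //= [/IH e]; rewrite !inE e.
by do ![case: (_ == _) | case: (_ \in _)].
Qed.

Lemma all_notin_fresh xs n ys : {subset ys <= xs} -> (fresh xs <= n)%N ->
  forall m, all [predC iota n m] ys.
Proof.
move=> sub le m; apply/allP => y /sub/fresh_gt lt; rewrite /= mem_iota negb_and -ltnNge.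
by rewrite (leq_trans lt le).
Qed.

Lemma mem_fv_tr p z : wf p -> (z \in fv (tr p)) = (z \in fv p).
Proof.
elim: p => //= [xs y _|xs ys /eqP sxy|p IHp q IHq /andP[/IHp ep /IHq eq]|
                p IHp q IHq /andP[/IHp ep /IHq eq]|x p IH /IH e|x p IH /IH e].
- set m := fresh _; set us := iota _ _; set n := (m + _)%N.
  have fr : ((z == y) || (z \in xs)) ==> (z \notin us) && (z != n).
    apply/implyP; rewrite -in_cons => /fresh_gt lt.
    by rewrite mem_iota leqNgt lt /= neq_ltn (leq_trans lt (leq_addr _ _)).
  rewrite mem_fv_alls mem_filter /= mem_cat mem_fv_neqs ?size_iota //= mem_rcons.
  rewrite !(inE, mem_cat).
  move: fr; case: (z == y); case: (z \in xs); case: (z \in us);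
    by case: (z == n).
- set m := fresh _; set zs := iota _ _.
  have fr : ((z \in xs) || (z \in ys)) ==> [&& z != m, z != m.+1 & z \notin zs].
    apply/implyP; rewrite -mem_cat => /fresh_gt lt.
    by rewrite mem_iota negb_and -ltnNge (ltn_eqF lt) (ltn_eqF (leqW lt)) /= (leqW (leqW lt)).
  rewrite (mem_fv_alls [:: _; _]) mem_fv_exs /= !mem_cat !mem_fv_eqs ?size_iota //= !inE.
  move: fr; case: (z \in xs); case: (z \in ys); case: (z \in zs);
    by case: (z == m); case: (z == m.+1).
- by rewrite !mem_cat ep eq.
- by rewrite !mem_cat ep eq.
- by rewrite !mem_filter e.
by rewrite !mem_filter e.
Qed.

(** The sorted free variables fix the arity of the distribution and the order of its arguments, so
    equal lists make both formulas speak about the same team. *)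
Lemma fvs_tr p : wf p -> fvs (tr p) = fvs p.
Proof.
move=> wfp; apply/perm_sortP; [exact: leq_total|exact: leq_trans|exact: anti_leq|].
by apply: uniq_perm; rewrite ?undup_uniq // => z; rewrite !mem_undup mem_fv_tr.
Qed.

Lemma tr_FO_ind p : wf p -> no_ind p -> wf (tr p) && no_depmid (tr p).
Proof.
have wf_alls us q : wf (alls us q) && no_depmid (alls us q) = wf q && no_depmid q.
  by elim: us.
have wf_exs us q : wf (exs us q) && no_depmid (exs us q) = wf q && no_depmid q.
  by elim: us.
have eqsP xs ys q : wf (eqs xs ys q) && no_depmid (eqs xs ys q) = wf q && no_depmid q.
  by rewrite /eqs; elim: (zip xs ys).
have neqsP xs ys q : wf (neqs xs ys q) && no_depmid (neqs xs ys q) = wf q && no_depmid q.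
  by rewrite /neqs; elim: (zip xs ys).
elim: p => //=.
- by move=> r xs ->.
- by move=> r xs ->.
- by move=> xs y _ _; rewrite wf_alls /= !andbT neqsP.
- move=> xs ys sz _; rewrite wf_exs /= !andbT.
  by rewrite andbACA !eqsP.
- by move=> p IHp q IHq /andP[wp wq] /andP[np nq]; rewrite andbACA IHp ?IHq.
by move=> p IHp q IHq /andP[wp wq] /andP[np nq]; rewrite andbACA IHp ?IHq.
Qed.

Lemma sat_tr (A : finType) (I : forall r : sym t, pred ((ar r).-tuple A)) p :
  (1 < #|A|)%N -> wf p -> no_ind p ->
  forall (D : {fset nat}) (X : {ffun D -> A} -> R), {subset fv p <= D} -> isPT X ->
  sat I p X <-> sat I (tr p) X.
Proof.
move=> A_gt1; elim: p => //.
- move=> xs y _ _ D X sub XT; rewrite [tr _]/=; set m := fresh _.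
  have sub' : {subset y :: xs <= D} by move=> z zyx; apply: sub; rewrite /= mem_rcons.
  apply: sat_dep_tr => //.
  + exact: iota_uniq.
  + exact: size_iota.
  + by rewrite mem_iota ltnn andbF.
  + by apply/negP => /fresh_gt; rewrite ltnNge leq_addr.
  exact: (all_notin_fresh (xs := y :: xs)).
- move=> xs ys /eqP sz _ D X sub XT; rewrite [tr _]/=; set m := fresh _.
  have fr ws : {subset ws <= xs ++ ys} -> all [predC [:: m; m.+1]] ws.
    by move=> s; apply: (@all_notin_fresh (xs ++ ys) m ws s (leqnn _) 2).
  have fr' ws : {subset ws <= xs ++ ys} -> all [predC iota m.+2 (size xs)] ws.
    by move=> s; apply: (@all_notin_fresh (xs ++ ys) m.+2 ws s); apply/leqW/leqW.
  have sx : {subset xs <= xs ++ ys} by move=> z zx; rewrite mem_cat zx.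
  have sy : {subset ys <= xs ++ ys} by move=> z zx; rewrite mem_cat zx orbT.
  apply: sat_mid_tr; rewrite ?iota_uniq ?size_iota //;
    try by [exact: fr | exact: fr' | move=> z /sx/sub | move=> z /sy/sub].
  + by rewrite neq_ltn leqnn.
  by rewrite /= !mem_iota !ltnn (ltnNge m.+1) leqW.
- move=> p IHp q IHq /andP[wp wq] /andP[np nq] D X sub XT /=.
  rewrite -(IHp wp np D X) // -?(IHq wq nq D X) //.
  + by move=> z zq; apply: sub; rewrite /= mem_cat zq orbT.
  by move=> z zp; apply: sub; rewrite /= mem_cat zp.
- move=> p IHp q IHq /andP[wp wq] /andP[np nq] D X sub XT /=.
  have sp : {subset fv p <= D} by move=> z zp; apply: sub; rewrite /= mem_cat zp.
  have sq : {subset fv q <= D} by move=> z zq; apply: sub; rewrite /= mem_cat zq orbT.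
  by split=> -[Y [Z [a [YT [ZT [a01 [XYZ [pY qZ]]]]]]]];
    exists Y, Z, a; do ![split=> //]; by [apply/(IHp wp np D) | apply/(IHq wq nq D)].
- move=> x p IH wp np D X sub XT /=; apply: (IH wp np).
    move=> z zp; rewrite !inE; case: (z =P x) => //= /eqP zx.
    by apply: sub; rewrite /= mem_filter /= zx.
  exact: (all_team_isPT (ltnW A_gt1) x XT).
move=> x p IH wp np D X sub XT /=.
have sub' : {subset fv p <= x |` D}.
  move=> z zp; rewrite !inE; case: (z =P x) => //= /eqP zx.
  by apply: sub; rewrite /= mem_filter /= zx.
by split=> -[Y [YT [XY pY]]]; exists Y; split=> //; split=> //; apply/(IH wp np).
Qed.

End Equivalence.

(** * Teams given by a distribution on tuples *)

Section ListTeams.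
Variables (R : realFieldType) (A : finType).

(** [team_of] with the formula replaced by its variable list: the type of [team_of p M] depends on
    [p], which would block the passage from [p] to [tr p]. *)
Definition list_team (L : seq nat) n (f : n.-tuple A -> R) :
    {ffun [fset x | x in L] -> A} -> R :=
  fun s => if vals_tot s L is Some a then
    (if (insub a : option (n.-tuple A)) is Some u then f u else 0) else 0.

Arguments list_team L {n} f s.

Lemma sum_list_team (L : seq nat) n (f : n.-tuple A -> R) (P : pred (seq (option A))) :
  (0 < #|A|)%N -> uniq L -> n = size L ->
  \sum_(s | P (vals s L)) list_team L f s = \sum_(u : n.-tuple A | P (map Some u)) f u.
Proof.
move=> /card_gt0P[a0 _] uL nL; rewrite {n}nL in f *.
pose g (u : (size L).-tuple A) : {ffun [fset x | x in L] -> A} :=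
  [ffun v => nth a0 u (index (val v) L)].
pose h (s : {ffun [fset x | x in L] -> A}) : (size L).-tuple A :=
  map_tuple (fun x => odflt a0 (sval s x)) (in_tuple L).
have inL x : (x \in [fset x | x in L]) = (x \in L) by rewrite !inE.
have gP u : vals (g u) L = map Some u.
  apply: (@eq_from_nth _ None); rewrite !size_map ?size_tuple // => i lti.
  rewrite (nth_map 0%N) // (nth_map a0) ?size_tuple //.
  by rewrite svalE ?inL ?mem_nth // => iL; rewrite ffunE /= index_uniq.
rewrite (reindex_onto g h) /=; last first.
  move=> s _; apply/ffunP => v; rewrite ffunE /=.
  have vL : val v \in L by rewrite -inL; apply: valP.
  by rewrite (nth_map 0%N) ?index_mem // nth_index // sval_val.
apply: eq_big => [u|u _].
  rewrite gP (_ : h (g u) == u) ?andbT //; apply/eqP/val_inj => /=.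
  apply: (@inj_map _ _ Some); first exact: Some_inj.
  rewrite -gP -map_comp; apply/eq_in_map => x xL /=.
  by rewrite svalE ?inL.
rewrite /list_team /vals_tot.
have -> : all (fun x => sval (g u) x != None) L.
  by apply/allP => x xL; rewrite sval_in inL.
have -> : pmap (sval (g u)) L = u.
  have pmap_map (k : nat -> option A) l : pmap k l = pmap id (map k l).
    by elim: l => //= x l ->.
  by rewrite pmap_map -[map _ _]/(vals (g u) L) gP; elim: (val u) => //= a l ->.
by rewrite valK.
Qed.

Lemma list_team_isPT (L : seq nat) n (f : n.-tuple A -> R) :
  (0 < #|A|)%N -> uniq L -> n = size L -> is_distr f -> isPT (list_team L f).
Proof.
move=> A0 uL nL [f0 f1]; split; last first.
  by left; rewrite -f1 -(sum_list_team f xpredT A0 uL nL).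
by move=> s; rewrite /list_team; case: vals_tot => // a; case: insub.
Qed.

End ListTeams.

Arguments list_team {R A} L {n} f s.

Lemma fvs_uniq (t : vocab) (p : form t) : uniq (fvs p).
Proof. by rewrite sort_uniq undup_uniq. Qed.

Lemma dep_mid_le_ind (R : realFieldType) : logic_le R FO_dep_mid FO_ind.
Proof.
move=> t p /andP[wp np]; exists (tr p); split; first exact: tr_FO_ind.
move=> M; have e := fvs_tr wp.
have sub : {subset fv p <= [fset x | x in fvs p]}.
  by move=> z zp; rewrite !inE mem_sort mem_undup.
have -> : InStruc (tr p) M <-> (1 < #|dA M|)%N /\ is_distr (@df _ _ M) /\
    dn M = size (fvs p) /\ sat (@dI _ _ M) (tr p) (list_team (fvs p) (@df _ _ M)).
  by rewrite -e.
rewrite /InStruc; split=> -[A1 [fd [nL pX]]]; do ![split=> //];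
  by apply/(sat_tr _ A1 wp np sub) => //; apply: list_team_isPT (ltnW A1) (fvs_uniq _) nL fd.
Qed.

(** * Satisfaction without independence atoms as a finite union of cones *)

Section Cones.
Variables (R : realFieldType) (t : vocab) (A : finType).
Hypothesis A_gt0 : (0 < #|A|)%N.
Variable I : forall r : sym t, pred ((ar r).-tuple A).
Implicit Types p q : form t.

Definition cone (D : {fset nat}) (C : ({ffun D -> A} -> R) -> Prop) :=
  (forall X Y, C X -> C Y -> C (fun s => X s + Y s)) /\
  (forall c X, 0 <= c -> C X -> C (fun s => c * X s)).

(** The cones consist of arbitrary functions into [R], possibly negative or unnormalised, and are
    compared with satisfaction on teams only. Finiteness of [K] is what the pigeonhole argument
    uses. *)
Definition union_of_cones (D : {fset nat}) p :=
  exists (K : finType) (C : K -> ({ffun D -> A} -> R) -> Prop),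
    (forall k, cone (C k)) /\
    (forall X, isPT X -> (sat I p X <-> exists k, C k X)).

(** The side condition [Q] lets an unsuitable index carry the empty set, which counts as a cone
    here, so the index type need not be cut down. *)
Lemma cone_null (D : {fset nat}) (P : pred {ffun D -> A}) (Q : Prop) :
  cone (fun X => Q /\ forall s, ~~ P s -> X s = 0).
Proof.
split=> [X Y [q X0] [_ Y0]|c X _ [q X0]]; split=> // s Ps.
  by rewrite X0 ?Y0 ?addr0.
by rewrite X0 ?mulr0.
Qed.

Lemma supp_null (D : {fset nat}) (X : {ffun D -> A} -> R) (P : pred {ffun D -> A}) :
  isPT X -> (forall s, 0 < X s -> P s) <-> (forall s, ~~ P s -> X s = 0).
Proof.
move=> XT; split=> h s Ps; last by apply: contraTT Ps => /h->; rewrite ltxx.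
apply/eqP; apply: contraNT Ps => X0; apply: h.
by rewrite lt0r X0 isPT_ge0.
Qed.

Lemma flat_union_of_cones (D : {fset nat}) p (P : pred {ffun D -> A}) :
  flat R I p P -> union_of_cones D p.
Proof.
move=> pP; exists unit, (fun _ X => True /\ forall s, ~~ P s -> X s = 0).
split=> [_|X XT]; first exact: cone_null.
rewrite pP // supp_null //; split=> [h|[_ []]//].
by exists tt.
Qed.

(** Cones are stable under intersection, under sums of nonnegative parts and under transfer along
    linear maps and relations, which handles conjunction, disjunction and the two quantifiers.
    Indices pair up at a binary connective and are kept at a quantifier. *)
Lemma sat_union_of_cones p : no_ind p -> forall D : {fset nat}, union_of_cones D p.
Proof.
elim: p => //=.
- move=> x y _ D.
  by apply: (@flat_union_of_cones _ _ (fun s => (sval s x != None) && (sval s x == sval s y))).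
- move=> x y _ D.
  by apply: (@flat_union_of_cones _ _
    (fun s => [&& sval s x != None, sval s y != None & sval s x != sval s y])).
- by move=> r xs _ D; apply: (@flat_union_of_cones _ _ (fun s => rel_holds I s r xs)).
- by move=> r xs _ D; apply: (@flat_union_of_cones _ _ (fun s => nrel_holds I s r xs)).
- move=> xs y _ D.
  (* The index [S] only has to contain the support, since dependence passes to subsets; demanding
     equality would break closure under scaling by [0]. *)
  pose dep (S : {set {ffun D -> A}}) := forall s s', s \in S -> s' \in S ->
    vals s xs = vals s' xs -> sval s y = sval s' y.
  exists {set {ffun D -> A}}, (fun S X => dep S /\ forall s, s \notin S -> X s = 0).
  split=> [S|X XT]; first exact: cone_null.
  split=> [h|[S [depS /(supp_null (mem S) XT) sub]]] /=.
    exists [set s | 0 < X s]; split; last first.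
      by apply/(supp_null _ XT) => s Xs; rewrite /= inE.
    by move=> s s'; rewrite !inE; apply: h.
  by move=> s s' /sub Xs /sub Xs'; apply: depS.
- move=> xs ys _ D; exists unit, (fun _ X => sat I (FMid xs ys) X).
  split=> [_|X XT]; last by split=> [h|[]//]; exists tt.
  split=> [X Y hX hY|c X _ hX] a; rewrite /mass; last first.
    by rewrite -!mulr_sumr; congr (_ * _); apply: hX.
  rewrite !big_split; congr (_ + _); [exact: hX|exact: hY].
- move=> p IHp q IHq /andP[/IHp{}IHp /IHq{}IHq] D.
  have [K [C [coneC satC]]] := IHp D; have [L [E [coneE satE]]] := IHq D.
  exists (K * L)%type, (fun k X => C k.1 X /\ E k.2 X); split=> [[k l] /=|X XT].
    have [addC scaleC] := coneC k; have [addE scaleE] := coneE l.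
    by split=> [X Y [CX EX] [CY EY]|c X c0 [CX EX]]; split; auto.
  rewrite /= satC // satE //; split=> [[[k Ck] [l El]]|[[k l] [Ck El]]]; first by exists (k, l).
  by split; [exists k|exists l].
- move=> p IHp q IHq /andP[/IHp{}IHp /IHq{}IHq] D.
  have [K [C [coneC satC]]] := IHp D; have [L [E [coneE satE]]] := IHq D.
  exists (K * L)%type, (fun k X => exists Y Z, [/\ forall s, 0 <= Y s, forall s, 0 <= Z s,
    forall s, X s = Y s + Z s, C k.1 Y & E k.2 Z]); split=> [[k l] /=|X XT].
    have [addC scaleC] := coneC k; have [addE scaleE] := coneE l.
    split=> [X Y [X1 [X2 [X10 X20 eX CX EX]]] [Y1 [Y2 [Y10 Y20 eY CY EY]]]|
             c X c0 [X1 [X2 [X10 X20 eX CX EX]]]].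
      exists (fun s => X1 s + Y1 s), (fun s => X2 s + Y2 s); split; auto.
      - by move=> s; apply: addr_ge0.
      - by move=> s; apply: addr_ge0.
      by move=> s; rewrite eX eY addrACA.
    exists (fun s => c * X1 s), (fun s => c * X2 s); split; auto.
    - by move=> s; apply: mulr_ge0.
    - by move=> s; apply: mulr_ge0.
    by move=> s; rewrite eX mulrDr.
  split=> [[Y [Z [a [YT [ZT [/andP[a0 a1] [XYZ [/(satC _ YT)[k Ck] /(satE _ ZT)[l El]]]]]]]]]|].
    have a1' : 0 <= 1 - a by rewrite subr_ge0.
    exists (k, l), (fun s => a * Y s), (fun s => (1 - a) * Z s); split=> //.
    - by move=> s; rewrite mulr_ge0 // isPT_ge0.
    - by move=> s; rewrite mulr_ge0 // isPT_ge0.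
    - by apply: (coneC k).2.
    by apply: (coneE l).2.
  move=> [[k l] [Y [Z [Y0 Z0 XYZ Ck El]]]].
  have [a a01 [c [d [c0 d0 YT ZT XYZ']]]] := isPT_split XT Y0 Z0 XYZ.
  exists (fun s => c * Y s), (fun s => d * Z s), a; do ![split=> //].
    by apply/(satC _ YT); exists k; apply: (coneC k).2.
  by apply/(satE _ ZT); exists l; apply: (coneE l).2.
- move=> x p IH /IH{}IH D; have [K [C [coneC satC]]] := IH (x |` D).
  exists K, (fun k X => C k (all_team x X)); split=> [k|X XT].
    have [addC scaleC] := coneC k; split=> [X Y CX CY|c X c0 CX].
      rewrite (_ : all_team _ _ = fun u => all_team x X u + all_team x Y u); first exact: addC.
      by apply: funext => u; rewrite /all_team big_split mulrDl.
    rewrite (_ : all_team _ _ = fun u => c * all_team x X u); first exact: scaleC.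
    by apply: funext => u; rewrite /all_team -mulr_sumr mulrA.
  exact: (satC _ (all_team_isPT A_gt0 x XT)).
move=> x p IH /IH{}IH D; have [K [C [coneC satC]]] := IH (x |` D).
exists K, (fun k X => exists Y, [/\ forall u, 0 <= Y u, same_marginal x X Y & C k Y]).
split=> [k|X XT].
  have [addC scaleC] := coneC k.
  split=> [X X' [Y [Y0 XY CY]] [Y' [Y'0 XY' CY']]|c X c0 [Y [Y0 XY CY]]].
    exists (fun u => Y u + Y' u); split; auto; first by move=> u; apply: addr_ge0.
    by move=> u; rewrite !big_split XY XY'.
  exists (fun u => c * Y u); split; auto; first by move=> u; apply: mulr_ge0.
  by move=> u; rewrite -!mulr_sumr XY.
split=> [[Y [YT [XY /(satC _ YT)[k Ck]]]]|[k [Y [Y0 XY Ck]]]].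
  by exists k, Y; split=> // u; apply: isPT_ge0.
have YT := same_marginal_isPT A_gt0 XT Y0 XY.
by exists Y; do ![split=> //]; apply/(satC _ YT); exists k.
Qed.

End Cones.

(** * Marginal independence is not a finite union of cones *)

Section Strictness.
Variable R : realFieldType.

Arguments team_of {R t} p M s.

Definition empty_vocab := @Vocab void (fun=> 0%N).

Definition ind01 : form empty_vocab := FInd [:: 0%N] [:: 1%N].

Definition bool_struc (f : 2.-tuple bool -> R) : dstruc R empty_vocab :=
  @DStruc R empty_vocab bool (fun r => match r with end) 2 f.

Lemma sum_pairs (P : pred (2.-tuple bool)) (f : 2.-tuple bool -> R) :
  \sum_(u | P u) f u = \sum_x \sum_(y | P [tuple x; y]) f [tuple x; y].
Proof.
rewrite pair_big_dep /=.
rewrite (reindex (fun c : bool * bool => [tuple c.1; c.2])) //=.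
exists (fun u : 2.-tuple bool => (tnth u ord0, tnth u ord_max)) => [[x y]|u] _ //=.
by apply/val_inj; case: u => [[|a [|b []]] sz].
Qed.

Lemma sat_ind01 (f : 2.-tuple bool -> R) : InStruc ind01 (bool_struc f) <->
  is_distr f /\ forall b c : seq bool,
    (\sum_x \sum_(y | [:: x] == b) f [tuple x; y]) *
    (\sum_x \sum_(y | [:: y] == c) f [tuple x; y]) =
    \sum_x \sum_(y | ([:: x] == b) && ([:: y] == c)) f [tuple x; y].
Proof.
have A0 : (0 < #|{: bool}|)%N by rewrite card_bool.
have massP (P : pred (seq (option bool))) :
    mass (team_of ind01 (bool_struc f)) (fun s => P (vals s [:: 0%N; 1%N])) =
    \sum_x \sum_(y | P [:: Some x; Some y]) f [tuple x; y].
  by rewrite -(sum_pairs (fun u => P (map Some u))) -(@sum_list_team R bool [:: 0%N; 1%N]).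
have Somes (b c : seq bool) : (map Some b == map Some c) = (b == c).
  by apply: inj_eq; apply: inj_map; apply: Some_inj.
have mass0 b : mass (team_of ind01 (bool_struc f)) (fun s => vals s [:: 0%N] == map Some b) =
    \sum_x \sum_(y | [:: x] == b) f [tuple x; y].
  (* [massP] sees only the whole list of values; [take 1] and [drop 1] single out the two
     variables. *)
  rewrite (massP (fun l => take 1 l == map Some b)).
  by apply: eq_bigr => x _; apply: eq_bigl => y; rewrite -Somes.
have mass1 c : mass (team_of ind01 (bool_struc f)) (fun s => vals s [:: 1%N] == map Some c) =
    \sum_x \sum_(y | [:: y] == c) f [tuple x; y].
  rewrite (massP (fun l => drop 1 l == map Some c)).
  by apply: eq_bigr => x _; apply: eq_bigl => y; rewrite -Somes.
have mass01 b c : mass (team_of ind01 (bool_struc f))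
    (fun s => (vals s [:: 0%N] == map Some b) && (vals s [:: 1%N] == map Some c)) =
    \sum_x \sum_(y | ([:: x] == b) && ([:: y] == c)) f [tuple x; y].
  rewrite (massP (fun l => (take 1 l == map Some b) && (drop 1 l == map Some c))).
  by apply: eq_bigr => x _; apply: eq_bigl => y; rewrite -!Somes.
have massT : is_distr f -> mass (team_of ind01 (bool_struc f)) predT = 1.
  move=> [_ <-]; rewrite (massP xpredT).
  by rewrite (sum_pairs xpredT).
rewrite /InStruc card_bool /=; split=> [[_ [fd [_ h]]]|[fd h]].
  by split=> // b c; have := h b c; rewrite mass0 mass1 mass01 massT // mulr1.
do ![split=> //]; move=> b c; rewrite mass0 mass1 mass01 massT // mulr1.
exact: h.
Qed.

Definition prod_distr (a : R) (u : 2.-tuple bool) : R :=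
  \prod_(i < 2) (if tnth u i then a else 1 - a).

Lemma prod_distrE a x y : prod_distr a [tuple x; y] =
  (if x then a else 1 - a) * (if y then a else 1 - a).
Proof. by rewrite /prod_distr big_ord_recl big_ord1. Qed.

Lemma prod_distr_is_distr a : 0 <= a <= 1 -> is_distr (prod_distr a).
Proof.
move=> /andP[a0 a1]; split.
  by move=> u; apply: prodr_ge0 => i _; case: ifP => // _; rewrite subr_ge0.
rewrite (sum_pairs xpredT) !big_bool !prod_distrE /=; ring.
Qed.

Lemma prod_distr_ind01 a : 0 <= a <= 1 -> InStruc ind01 (bool_struc (prod_distr a)).
Proof.
move=> a01; apply/sat_ind01; split; first exact: prod_distr_is_distr.
have sumT : \sum_(x : bool) (if x then a else 1 - a) = 1 by rewrite big_bool /= addrC subrK.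
move=> b c.
have -> : \sum_x \sum_(y | [:: x] == b) prod_distr a [tuple x; y] =
    \sum_(x | [:: x] == b) (if x then a else 1 - a).
  rewrite [RHS]big_mkcond; apply: eq_bigr => x _; case: eqP => _; last by rewrite big_pred0.
  by under eq_bigr do rewrite prod_distrE; rewrite -mulr_sumr sumT mulr1.
have -> : \sum_x \sum_(y | [:: y] == c) prod_distr a [tuple x; y] =
    \sum_(y | [:: y] == c) (if y then a else 1 - a).
  under eq_bigr => x _ do (under eq_bigr do rewrite prod_distrE; rewrite -mulr_sumr).
  by rewrite -mulr_suml sumT mul1r.
rewrite mulr_suml big_mkcond; apply: eq_bigr => x _; case: eqP => _; last by rewrite big_pred0.
by rewrite mulr_sumr; apply: eq_bigr => y _; rewrite prod_distrE.
Qed.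

(** At [(true, true)] the midpoint misses independence by [(a^2 + b^2)/2 - ((a + b)/2)^2 = (a -
    b)^2/4]. *)
Lemma midpoint_ind01 a b :
  InStruc ind01 (bool_struc (fun u => 2^-1 * (prod_distr a u + prod_distr b u))) -> a = b.
Proof.
move=> /sat_ind01[_ /(_ [:: true] [:: true])].
rewrite !big_bool; do ![rewrite big_mkcond big_bool /=]; rewrite !prod_distrE /=.
move=> e; have : (a - b) ^+ 2 = 0 by lra.
by move/eqP; rewrite sqrf_eq0 subr_eq0 => /eqP.
Qed.

Lemma list_team_cone (A : finType) L n (f g : n.-tuple A -> R) c :
  list_team L (fun u => c * (f u + g u)) = fun s => c * (list_team L f s + list_team L g s).
Proof.
apply: funext => s; rewrite /list_team; case: vals_tot => [l|]; last by rewrite addr0 mulr0.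
by case: insub => //; rewrite addr0 mulr0.
Qed.

Lemma not_ind_le_dep_mid : ~ logic_le R FO_ind FO_dep_mid.
Proof.
move=> /(_ empty_vocab ind01 isT)[q [/andP[_ nq] qP]].
have A0 : (0 < #|{: bool}|)%N by rewrite card_bool.
pose a n : R := (n.+1%:R)^-1.
have a01 n : 0 <= a n <= 1.
  by rewrite invr_ge0 ler0n invf_le1 ?ltr0n // ler1n.
pose M f := bool_struc f.
(* The distribution [prod_distr 0] is a placeholder: the interpretation does not depend on it, so
   one finite family of cones serves every [n]. *)
have [K [C [coneC satC]]] := sat_union_of_cones R A0 (@dI _ _ (M (prod_distr 0))) nq (fvD q).
have inq n : InStruc q (M (prod_distr (a n))) by apply/qP/prod_distr_ind01.
have team f : is_distr f -> 2 = size (fvs q) -> isPT (team_of q (M f)).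
  by move=> fd sz; apply: list_team_isPT A0 (fvs_uniq q) sz fd.
have sz : 2 = size (fvs q) by case: (inq 0) => _ [_ []].
have kP n : exists k, C k (team_of q (M (prod_distr (a n)))).
  apply/satC; first by apply: team sz; apply: prod_distr_is_distr.
  by case: (inq n) => _ [_ [_]].
pose k n := projT1 (cid (kP n)).
have Ck n : C (k n) (team_of q (M (prod_distr (a n)))) by rewrite /k; case: cid.
have [n [m [nm ek]]] : exists n m, n <> m /\ k n = k m.
  have /injectivePn[i [j ij eij]] : ~~ injectiveb (fun i : 'I_#|K|.+1 => k i).
    by apply/negP => /injectiveP/leq_card; rewrite card_ord ltnn.
  by exists i, j; split=> // /val_inj/eqP; rewrite (negbTE ij).
have anm : a n = a m.
  apply: midpoint_ind01; apply/qP.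
  have [dn0 dn1] := prod_distr_is_distr (a01 n).
  have [dm0 dm1] := prod_distr_is_distr (a01 m).
  have fd : is_distr (fun u => 2^-1 * (prod_distr (a n) u + prod_distr (a m) u)).
    split=> [u|]; first by rewrite mulr_ge0 ?invr_ge0 ?ler0n // addr_ge0.
    by rewrite -mulr_sumr big_split /= dn1 dm1; field.
  split; first by rewrite card_bool.
  do 2![split=> //]; apply/(satC _ (team _ fd sz)); exists (k n).
  have e := list_team_cone (fvs q) (prod_distr (a n)) (prod_distr (a m)) 2^-1.
  refine (eq_ind_r (C (k n)) _ e); have [addC scaleC] := coneC (k n).
  apply: scaleC; first by rewrite invr_ge0 ler0n.
  by apply: addC; [exact: Ck|rewrite ek; exact: Ck].
by move: anm => /invr_inj/eqP; rewrite eqr_nat eqSS => /eqP.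
Qed.

End Strictness.

Theorem mainTheorem19 (R : realType) :
  logic_lt R FO_dep_mid FO_ind.
Proof. by split; [exact: dep_mid_le_ind | exact: not_ind_le_dep_mid]. Qed.
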